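(* Let $f:\mathbb{R}^n\to\mathbb{R}^n$ and $h:\mathbb{R}^n\to\mathbb{R}^m$. Assume there exist a complete $C^2$ Riemannian metric $P$ on $\mathbb{R}^n$, with Riemannian distance $d$, and a set $\mathcal{C}\subset\mathbb{R}^n$ such that: (i) $\mathcal{C}$ is geodesically convex, closed, and with nonempty interior; (ii) there exist a $C^1$ function $\rho:\mathbb{R}^n\to[0,+\infty)$ and a strictly positive real number $q$ such that $$\mathcal{L}_fP(x)\le\rho(x)\,\frac{\partial h}{\partial x}(x)^\top\frac{\partial h}{\partial x}(x)-q\,P(x)\qquad\forall x\in\mathcal{C};$$ (iii) the number of outputs is $m=1$ and, for each $y\in h(\mathcal{C})$, the set $\mathfrak{H}(y)\cap\mathcal{C}$, where $\mathfrak{H}(y)=\{x\in\mathbb{R}^n:h(x)=y\}$, is totally geodesic. Let $\delta(y_1,y_2)=|y_1-y_2|^2$. Then, for any positive real number $E$, there exists a continuous function $k_E:\mathbb{R}^n\to\mathbb{R}$ such that, with the observer $\dot{\hat x}=F(\hat x,y)$ given by $$F(\hat x,y)=f(\hat x)-k_E(\hat x)\,P(\hat x)^{-1}\frac{\partial h}{\partial x}(\hat x)^\top\frac{\partial\delta}{\partial y_1}(h(\hat x),y),$$ the following holds: $$\mathfrak{D}^+d(\hat x,x)\le-\frac{q}{4}\,d(\hat x,x)\qquad\forall(x,\hat x)\in\{(x,\hat x):d(\hat x,x)<E\}\cap\big(\mathrm{int}(\mathcal{C})\times\mathrm{int}(\mathcal{C})\big).$$ Moreover, this expression of $F$ is intrinsic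 (i.e., coordinate independent), and it gives an observer with infinite gain margin with respect to $P$.
   Context: Standing assumptions: $f,h$ are differentiable sufficiently many times, and systems are forward complete (each solution exists on $[0,+\infty)$). The system is $\dot x=f(x)$, $y=h(x)$. Riemannian metric: a symmetric covariant two-tensor $P:\mathbb{R}^n\to\mathbb{R}^{n\times n}$ with positive definite values. The length of a path $\gamma$ on $[s_1,s_2]$ is $\int_{s_1}^{s_2}\sqrt{\frac{d\gamma}{ds}(s)^\top P(\gamma(s))\frac{d\gamma}{ds}(s)}\,ds$; $d(x_1,x_2)$ is the minimum of lengths over piecewise $C^1$ paths between $x_1$ and $x_2$. $P$ is complete if every geodesic can be maximally extended to $\mathbb{R}$. Geodesics are normalized: $\frac{d\gamma}{ds}(s)^\top P(\gamma(s))\frac{d\gamma}{ds}(s)=1$. A minimal geodesic between two points is one whose length equals their distance. Lie derivative: for all $v\in\mathbb{R}^n$, $v^\top\mathcal{L}_fP(x)v=\frac{\partial}{\partial x}(v^\top P(x)v)f(x)+2v^\top P(x)\frac{\partial f}{\partial x}(x)v$. Matrix inequalities are in the sense of quadratic forms. Dini derivative: with $(X(x,t),\hat X((\hat x,x),t))$ the solution of $\dot x=f(x)$, $\dot{\hat x}=F(\hat x,h(x))$ issued from $(x,\hat x)$, $\mathfrak{D}^+d(\hat x,x)=\limsup_{t\to0_+}\frac{d(\hat X((\hat x,x),t),X(x,t))-d(\hat x,x)}{t}$. Geodesically convex: a subset $S\subset\mathbb{R}^n$ is geodesically convex if for any $(x_1,x_2)\in S\times S$ there exists a minimal geodesic $\gamma^*$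 between $x_1=\gamma^*(s_1)$ and $x_2=\gamma^*(s_2)$ with $\gamma^*(s)\in S$ for all $s\in[s_1,s_2]$. Totally geodesic: given a $C^1$ function $\varphi:\mathbb{R}^n\to\mathbb{R}^m$ and a closed set $\mathcal{C}\subset\mathbb{R}^n$, the set $S=\{x:\varphi(x)=0\}\cap\mathcal{C}$ is totally geodesic if, for any $(x,v)\in S\times\mathbb{R}^n$ with $\frac{\partial\varphi}{\partial x}(x)v=0$ and $v^\top P(x)v=1$, any geodesic $\gamma$ with $\gamma(0)=x$, $\frac{d\gamma}{ds}(0)=v$ satisfies $\varphi(\gamma(s))=0$ for all $s\in J_\gamma$, where $J_\gamma$ is the maximal interval containing $0$ such that $\gamma(J_\gamma)\subset\mathcal{C}$. For $\mathfrak{H}(y)\cap\mathcal{C}$ take $\varphi=h-y$. Infinite gain margin with respect to $P$: the observer $\dot{\hat x}=F(\hat x,y)$ for $\dot x=f(x)$ has an infinite gain margin with respect to $P$ if $F(x,h(x))=f(x)$ for every $x\in\mathbb{R}^n$ and, for any geodesic $\gamma^*$ minimal on $[0,\hat s)$, $$\frac{d\gamma^*}{ds}(s)^\top P(\gamma^*(s))\big[F(\gamma^*(s),h(\gamma^*(0)))-f(\gamma^*(s))\big]<0\qquad\forall s\in(0,\hat s).$$ Intrinsic: for any diffeomorphism $\phi$ of $\mathbb{R}^n$ with $\bar x=\phi(x)$, $\bar{\hat x}=\phi(\hat x)$, let $\bar h(\bar x)=h(x)$, $\bar k_E(\bar x)=k_E(x)$, $\bar f(\bar x)=\frac{\partial\phi}{\partial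 x}(x)f(x)$, $\bar F(\bar x,y)=\frac{\partial\phi}{\partial x}(x)F(x,y)$, and $\bar P$ be given by $P(x)=\frac{\partial\phi}{\partial x}(x)^\top\bar P(\bar x)\frac{\partial\phi}{\partial x}(x)$; then $\bar F(\bar{\hat x},y)=\bar f(\bar{\hat x})-\bar k_E(\bar{\hat x})\bar P(\bar{\hat x})^{-1}\frac{\partial\bar h}{\partial\bar x}(\bar{\hat x})^\top\frac{\partial\delta}{\partial y_1}(\bar h(\bar{\hat x}),y)$.
   Formalization: The infinite gain margin inequality, false as stated, is required only along minimal geodesics lying in C and only at s where h(γ*(s)) ≠ h(γ*(0)); where the outputs agree the quantity is 0, and outside C the function h is unconstrained. *)

(* Defs.v *)
From mathcomp Require Import all_boot all_order all_algebra.
From mathcomp Require Import all_classical all_reals all_analysis.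

Set Implicit Arguments.
Unset Strict Implicit.
Unset Printing Implicit Defensive.

Import Order.TTheory GRing.Theory Num.Theory.
Import numFieldNormedType.Exports.

Local Open Scope classical_set_scope.
Local Open Scope ring_scope.

(* Vectors are row vectors. In the library [jacobian f x] satisfies
   'D_v f x = v *m jacobian f x, so it is the TRANSPOSE of the matrix df/dx
   acting on column vectors; every matrix formula below is the transpose of the
   usual column-vector one. *)

(* Class C^k. On a finite-dimensional domain, continuity of every directional
   derivative is continuity of the differential. *)
Fixpoint Ck (R : realType) (V W : normedModType R) (k : nat) (f : V -> W)
    : Prop :=
  if k is k'.+1 then
    (forall x, differentiable f x) /\ (forall v, Ck k' (fun x => 'D_v f x))
  else continuous f.

(* u^T A v in column-vector notation. *)
Definition inner (R : realType) (n : nat) (A : 'M[R]_n) (u v : 'rV[R]_n) : R :=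
  (u *m A *m v^T) 0 0.

Definition riemannian_metric (R : realType) (n : nat)
    (P : 'rV[R]_n -> 'M[R]_n) : Prop :=
  forall x, (P x)^T = P x /\ (forall v, v != 0 -> 0 < inner (P x) v v).

Definition partial (R : realType) (n : nat) (i : 'I_n) (g : 'rV[R]_n -> R)
    (x : 'rV[R]_n) : R :=
  'D_(delta_mx 0 i) g x.

Definition christoffel (R : realType) (n : nat) (P : 'rV[R]_n -> 'M[R]_n)
    (x : 'rV[R]_n) (k i j : 'I_n) : R :=
  2^-1 * \sum_l invmx (P x) k l *
    (partial i (fun z => P z l j) x + partial j (fun z => P z l i) x
     - partial l (fun z => P z i j) x).

(* Normalized geodesic on a nonempty open interval I; the values of gamma
   outside I are irrelevant. *)
Definition geodesic (R : realType) (n : nat) (P : 'rV[R]_n -> 'M[R]_n)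
    (I : set R) (gamma : R -> 'rV[R]_n) : Prop :=
  [/\ open I, is_interval I, I !=set0 &
    forall s, I s ->
      [/\ derivable gamma s 1,
          derivable (derive1 gamma) s 1,
          derive1 (derive1 gamma) s =
            - \row_k \sum_i \sum_j christoffel P (gamma s) k i j *
                derive1 gamma s 0 i * derive1 gamma s 0 j &
          inner (P (gamma s)) (derive1 gamma s) (derive1 gamma s) = 1]].

Definition complete_metric (R : realType) (n : nat)
    (P : 'rV[R]_n -> 'M[R]_n) : Prop :=
  forall I gamma, geodesic P I gamma ->
    exists gamma', geodesic P setT gamma' /\
      forall s, I s -> gamma' s = gamma s.

(* A piece is C^1 up to both endpoints iff it is the restriction of a C^1 curve
   defined on the whole line; continuity at the breakpoints follows because
   consecutive pieces share the value of gamma there. *)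
Inductive piecewise_C1 (R : realType) (n : nat) (gamma : R -> 'rV[R]_n)
    : R -> R -> Prop :=
| piecewise_C1_piece (a b : R) (g : R -> 'rV[R]_n) :
    a < b -> Ck 1 g -> (forall s, a <= s <= b -> gamma s = g s) ->
    piecewise_C1 gamma a b
| piecewise_C1_glue (a b c : R) :
    piecewise_C1 gamma a b -> piecewise_C1 gamma b c -> piecewise_C1 gamma a c.

(* [derive1 gamma] is meaningless at the finitely many breakpoints, which are
   negligible for the Lebesgue measure. *)
Definition path_length (R : realType) (n : nat) (P : 'rV[R]_n -> 'M[R]_n)
    (gamma : R -> 'rV[R]_n) (s1 s2 : R) : R :=
  \int[@lebesgue_measure R]_(s in `[s1, s2])
    Num.sqrt (inner (P (gamma s)) (derive1 gamma s) (derive1 gamma s)).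

Definition dist (R : realType) (n : nat) (P : 'rV[R]_n -> 'M[R]_n)
    (x1 x2 : 'rV[R]_n) : R :=
  inf [set l | exists s1 s2 gamma,
         [/\ piecewise_C1 gamma s1 s2, gamma s1 = x1, gamma s2 = x2 &
             l = path_length P gamma s1 s2]].

Definition minimal_geodesic (R : realType) (n : nat)
    (P : 'rV[R]_n -> 'M[R]_n) (gamma : R -> 'rV[R]_n) (s1 s2 : R) : Prop :=
  [/\ s1 <= s2,
      exists I, geodesic P I gamma /\ `[s1, s2] `<=` I &
      path_length P gamma s1 s2 = dist P (gamma s1) (gamma s2)].

Definition geodesically_convex (R : realType) (n : nat)
    (P : 'rV[R]_n -> 'M[R]_n) (S : set 'rV[R]_n) : Prop :=
  forall x1 x2, S x1 -> S x2 ->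
    exists gamma s1 s2,
      [/\ minimal_geodesic P gamma s1 s2, gamma s1 = x1, gamma s2 = x2 &
          forall s, s1 <= s <= s2 -> S (gamma s)].

(* J_gamma: the largest interval containing 0, inside the domain I of gamma,
   that gamma maps into C. *)
Definition stay_interval (R : realType) (n : nat) (C : set 'rV[R]_n)
    (I : set R) (gamma : R -> 'rV[R]_n) : set R :=
  \bigcup_(J in [set J : set R |
      [/\ is_interval J, J 0, J `<=` I & gamma @` J `<=` C]]) J.

(* S = {phi = 0} `&` C is totally geodesic; the condition involves phi and C,
   not only the set S. *)
Definition totally_geodesic (R : realType) (n m : nat)
    (P : 'rV[R]_n -> 'M[R]_n) (phi : 'rV[R]_n -> 'rV[R]_m)
    (C : set 'rV[R]_n) : Prop :=
  forall x v, phi x = 0 -> C x ->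
    v *m jacobian phi x = 0 -> inner (P x) v v = 1 ->
    forall I gamma, geodesic P I gamma -> I 0 ->
      gamma 0 = x -> derive1 gamma 0 = v ->
      forall s, stay_interval C I gamma s -> phi (gamma s) = 0.

(* v^T (L_f P)(x) v *)
Definition lie_form (R : realType) (n : nat) (f : 'rV[R]_n -> 'rV[R]_n)
    (P : 'rV[R]_n -> 'M[R]_n) (x v : 'rV[R]_n) : R :=
  'D_(f x) (fun z => inner (P z) v v) x +
  2 * inner (P x) v (v *m jacobian f x).

(* X solves dX/dt = g t X on [0, T); for continuous right-hand sides the
   right derivative at 0 is recovered from continuity there. *)
Definition solution (R : realType) (n : nat)
    (g : R -> 'rV[R]_n -> 'rV[R]_n) (T : R) (X : R -> 'rV[R]_n) : Prop :=
  {within `[0, T[, continuous X} /\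
  (forall t : R, 0 < t < T -> is_derive t (1 : R) X (g t (X t))).

Definition forward_complete (R : realType) (n : nat)
    (f : 'rV[R]_n -> 'rV[R]_n) : Prop :=
  forall T X, 0 < T -> solution (fun=> f) T X ->
    exists Y, (forall T', 0 < T' -> solution (fun=> f) T' Y) /\
      (forall t, 0 <= t < T -> Y t = X t).

Definition upper_dini (R : realType) (g : R -> R) : \bar R :=
  limf_esup (fun t => ((g t - g 0) / t)%:E) (0 : R)^'+.

Definition sqdist (R : realType) (m : nat) (y1 y2 : 'rV[R]_m) : R :=
  \sum_j (y1 0 j - y2 0 j) ^+ 2.

(* d delta / d y1 at (y1, y2), as a row vector *)
Definition grad1 (R : realType) (m : nat)
    (delta : 'rV[R]_m -> 'rV[R]_m -> R) (y1 y2 : 'rV[R]_m) : 'rV[R]_m :=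
  \row_j partial j (fun z => delta z y2) y1.

Definition observer (R : realType) (n m : nat)
    (delta : 'rV[R]_m -> 'rV[R]_m -> R) (P : 'rV[R]_n -> 'M[R]_n)
    (f : 'rV[R]_n -> 'rV[R]_n) (h : 'rV[R]_n -> 'rV[R]_m)
    (k : 'rV[R]_n -> R) (xhat : 'rV[R]_n) (y : 'rV[R]_m) : 'rV[R]_n :=
  f xhat -
  k xhat *: (grad1 delta (h xhat) y *m (jacobian h xhat)^T *m invmx (P xhat)).

Definition diffeomorphism (R : realType) (n : nat)
    (phi : 'rV[R]_n -> 'rV[R]_n) : Prop :=
  exists psi, [/\ cancel phi psi, cancel psi phi, Ck 1 phi & Ck 1 psi].

(* F, given by [observer] in the coordinates x, is given by the same formula in
   the coordinates phi x. *)
Definition intrinsic (R : realType) (n m : nat)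
    (delta : 'rV[R]_m -> 'rV[R]_m -> R) (P : 'rV[R]_n -> 'M[R]_n)
    (f : 'rV[R]_n -> 'rV[R]_n) (h : 'rV[R]_n -> 'rV[R]_m)
    (k : 'rV[R]_n -> R) (F : 'rV[R]_n -> 'rV[R]_m -> 'rV[R]_n) : Prop :=
  forall phi, diffeomorphism phi ->
  forall (hb : 'rV[R]_n -> 'rV[R]_m) (kb : 'rV[R]_n -> R)
         (fb : 'rV[R]_n -> 'rV[R]_n) (Fb : 'rV[R]_n -> 'rV[R]_m -> 'rV[R]_n)
         (Pb : 'rV[R]_n -> 'M[R]_n),
    (forall x, hb (phi x) = h x) ->
    (forall x, kb (phi x) = k x) ->
    (forall x, fb (phi x) = f x *m jacobian phi x) ->
    (forall x y, Fb (phi x) y = F x y *m jacobian phi x) ->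
    (forall x, P x = jacobian phi x *m Pb (phi x) *m (jacobian phi x)^T) ->
  forall xhat y, Fb (phi xhat) y = observer delta Pb fb hb kb (phi xhat) y.

(* gamma is a geodesic minimal on [0, shat). *)
Definition geodesic_minimal_on (R : realType) (n : nat)
    (P : 'rV[R]_n -> 'M[R]_n) (gamma : R -> 'rV[R]_n) (shat : R) : Prop :=
  (exists I, geodesic P I gamma /\ `[0, shat[ `<=` I) /\
  (forall s1 s2, 0 <= s1 -> s1 <= s2 -> s2 < shat ->
     path_length P gamma s1 s2 = dist P (gamma s1) (gamma s2)).

(* The strict inequality is asked along minimal geodesics of C, because h is
   unconstrained outside C, and at the points whose output differs from
   h (gamma 0): where the outputs agree, the first clause forces
   F (gamma s) (h (gamma 0)) = f (gamma s), so the left-hand side is 0. *)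
Definition infinite_gain_margin_on (R : realType) (n m : nat)
    (C : set 'rV[R]_n) (P : 'rV[R]_n -> 'M[R]_n) (f : 'rV[R]_n -> 'rV[R]_n)
    (h : 'rV[R]_n -> 'rV[R]_m) (F : 'rV[R]_n -> 'rV[R]_m -> 'rV[R]_n) : Prop :=
  (forall x, F x (h x) = f x) /\
  (forall gamma shat, geodesic_minimal_on P gamma shat ->
     (forall s, 0 <= s < shat -> C (gamma s)) ->
     forall s, 0 < s < shat -> h (gamma s) != h (gamma 0) ->
       inner (P (gamma s)) (derive1 gamma s)
         (F (gamma s) (h (gamma 0)) - f (gamma s)) < 0).

(* Main.v *)
Require Import Defs.
From mathcomp Require Import all_boot all_order all_algebra.
From mathcomp Require Import all_classical all_reals all_analysis.
From mathcomp Require Import ring lra.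

Set Implicit Arguments.
Unset Strict Implicit.
Unset Printing Implicit Defensive.

Import Order.TTheory GRing.Theory Num.Theory.
Import numFieldNormedType.Exports.

Local Open Scope classical_set_scope.
Local Open Scope ring_scope.

(** The distance between the estimate and the state is compared with the length of a
moving curve. Join xhat to x by a minimal geodesic gamma in C, of length L. Displacing
its ends along the two solutions and interpolating linearly in between gives a
competitor, so the Dini derivative of the distance is at most
<gamma'(L), f(x)> - <gamma'(0), F(xhat, h(x))>. Half the Lie derivative of P is the
derivative of <gamma', f> along gamma, and the observer correction contributes
- 2 k(xhat) r(0) (h(x) - h(xhat)), where r is the derivative of h along gamma
(variation_length, first_variation, inner_observer, drift_estimate).

On C, half the Lie derivative of P is at most rho r^2 / 2 - q / 2, so the term
rho r^2 / 2 has to be absorbed by the correction. This is where the level sets enter: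
if r vanishes at one point of a segment in C, the geodesic is tangent to a level set,
remains in it, and r vanishes identically. Hence r has constant sign, the correction is
the integral of - 2 k(xhat) |r(0)| |r|, and it suffices to find k with
rho r(s)^2 / 2 <= q / 4 + 2 k |r(s)| |r(0)| for all s in [0, E].

Such a k exists locally uniformly in xhat by compactness (gain_near, gain_exists): near
a geodesic with r(s) = 0 the left-hand side is small, and near one with r(s) nonzero,
r(0) is nonzero too and a large k is enough. The compactness argument needs
geodesics to depend continuously on their initial states and the set of initial states
to be closed. Both follow from Gronwall estimates and the completeness of P: a limit of
initial states starts a short geodesic, obtained as a limit of geodesics, and
completeness prolongs it (limit_solution, initial_states_closed, geodesic_dependence).
A continuous function then dominates the gains chosen on the balls of integer radius.

The gain margin is the same sign property of r, and the intrinsic character is the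
chain rule. *)

(** * Functions that are Lipschitz on balls *)

Section coordinates.
Context {R : realType}.

Lemma ler_coord_norm m n (A : 'M[R]_(m, n)) i j : `|A i j| <= `|A|.
Proof.
rewrite [leRHS]/Num.Def.normr/= mx_normrE.
exact: (le_bigmax _ (fun i : 'I_m * 'I_n => `|A i.1 i.2|) (i, j)).
Qed.

Lemma mx_norm_le m n (A : 'M[R]_(m, n)) c :
  0 <= c -> (forall i j, `|A i j| <= c) -> `|A| <= c.
Proof.
move=> c0 Ac; rewrite [leLHS]/Num.Def.normr/= mx_normrE.
by apply: bigmax_le => // -[i j] _; exact: Ac.
Qed.

Lemma is_derive_mxP (V : normedModType R) m n (M : V -> 'M[R]_(m, n)) t v D :
  is_derive t v M D <-> forall i j, is_derive t v (fun x => M x i j) (D i j).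
Proof.
split=> [[Mt <-] i j|Mt].
  rewrite derive_mx// mxE; apply/derivableP.
  by move/derivable_mxP : Mt.
have Md : derivable M t v.
  by apply/derivable_mxP => i j; have [] := Mt i j.
apply: DeriveDef => //; rewrite derive_mx//; apply/matrixP => i j.
by rewrite mxE; have [_ ->] := Mt i j.
Qed.

(** The chain rule for curves, with the outer derivative kept directional: this is
the form in which every derivative along a geodesic is computed. *)
Lemma is_derive_comp1 (V W : normedModType R) (F : V -> W) (g : R -> V) s v :
  differentiable F (g s) -> is_derive s 1 g v ->
  is_derive s 1 (fun t => F (g t)) ('D_v F (g s)).
Proof.
move=> dF [dg gv].
have dg' : differentiable g s by exact/derivable1_diffP.
apply: DeriveDef.
  apply/derivable1_diffP; exact: (differentiable_comp dg' dF).
rewrite (@deriveE _ _ _ (F \o g)); last exact: differentiable_comp.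
by rewrite diff_comp//= deriveE// -gv deriveE.
Qed.

(** Directional derivatives along the canonical basis determine all the others, so
continuity or Lipschitz bounds need only be checked on the basis. *)
Lemma derive_coord n (W : normedModType R) (F : 'rV[R]_n -> W) x v :
  differentiable F x ->
  'D_v F x = \sum_i v 0 i *: 'D_(delta_mx 0 i) F x.
Proof.
move=> dF; rewrite deriveE// {1}(row_sum_delta v) linear_sum.
by apply: eq_bigr => i _; rewrite linearZ deriveE.
Qed.

Lemma jacobian_eq n m (f : 'rV[R]_n -> 'rV[R]_m) x (J : 'M[R]_(n, m)) :
  differentiable f x -> (forall v : 'rV[R]_n, 'D_v f x = v *m J) ->
  jacobian f x = J.
Proof.
move=> df fJ; have E v := deriveEjacobian v df.
move: E; set J' := jacobian f x => E; clearbody J'.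
by apply/row_matrixP => i; rewrite (rowE i J') (rowE i J) -E fJ.
Qed.

Lemma closed_ball_compact n (r : R) : compact [set x : 'rV[R]_n | `|x| <= r].
Proof.
apply: bounded_closed_compact.
  exists r; split; first exact: num_real.
  by move=> s rs x /= xr; exact: (le_trans xr (ltW rs)).
apply: (@preimage_closed _ _ (fun x : 'rV[R]_n => `|x|) [set y : R | y <= r]).
  by move=> x _; exact: norm_continuous.
exact: closed_le.
Qed.

Lemma continuous_bounded_on_balls n (W : normedModType R)
    (F : 'rV[R]_n -> W) r : continuous F ->
  exists2 M, 0 <= M & forall x, `|x| <= r -> `|F x| <= M.
Proof.
move=> cF.
have [[x0 x0r]|B0] := pselect (exists x : 'rV[R]_n, `|x| <= r); last first.
  by exists 0 => // x xr; exfalso; apply: B0; exists x.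
have cFn : {within [set x : 'rV[R]_n | `|x| <= r],
    continuous (fun x => `|F x|)}.
  by apply: continuous_subspaceT => x; apply: continuous_comp; [exact: cF|exact: norm_continuous].
have [|c _ Fc] := EVT_max_rV _ (@closed_ball_compact n r) cFn.
  by exists x0.
by exists `|F c| => // x xr; apply: Fc; rewrite inE.
Qed.

End coordinates.

Section lipschitz.
Context {R : realType}.

(** Being Lipschitz on every ball is closed under the algebraic operations that build
the geodesic field, and it supplies at once the constants that Gronwall estimates
and Taylor bounds need on a bounded set. *)
Definition lip_on_balls (V W : normedModType R) (F : V -> W) :=
  forall r, exists2 L, 0 <= L & forall x y, `|x| <= r -> `|y| <= r ->
    `|F x - F y| <= L * `|x - y|.

Lemma lip_continuous (V W : normedModType R) (F : V -> W) :
  lip_on_balls F -> continuous F.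
Proof.
move=> Fl x; have [L L0 FL] := Fl (`|x| + 1).
apply/cvgrPdist_lt => e e0.
near=> y.
have yx : `|x - y| < 1 by near: y; apply: cvgr_dist_lt => //; exact: ltr01.
have yr : `|y| <= `|x| + 1.
  rewrite -[y](subKr x) (le_trans (ler_normB _ _))// lerD2l ltW//.
apply: (le_lt_trans (FL _ _ _ yr)); first by rewrite lerDl.
apply: (@le_lt_trans _ _ ((L + 1) * `|x - y|)).
  by rewrite ler_wpM2r// lerDl.
rewrite -ltr_pdivlMl; last by rewrite ltr_wpDl.
near: y; apply: cvgr_dist_lt => //.
by rewrite mulr_gt0// invr_gt0 ltr_wpDl.
Unshelve. all: by end_near. Qed.

Lemma lip_bounded (V W : normedModType R) (F : V -> W) : lip_on_balls F ->
  forall r, exists2 M, 0 <= M & forall x, `|x| <= r -> `|F x| <= M.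
Proof.
move=> Fl r; have [L L0 FL] := Fl `|r|.
exists (`|F 0| + L * `|r|); first by rewrite addr_ge0// mulr_ge0.
move=> x xr.
have xr' : `|x| <= `|r| by rewrite (le_trans xr)// ler_norm.
rewrite -[F x](subrK (F 0)) addrC (le_trans (ler_normD _ _))// lerD2l.
rewrite (le_trans (FL x 0 _ _)) ?normr0 ?subr0// ler_wpM2l//.
Qed.

Lemma lip_cst (V W : normedModType R) (c : W) :
  lip_on_balls (fun _ : V => c).
Proof. by move=> r; exists 0 => // x y _ _; rewrite subrr normr0 mul0r. Qed.

Lemma lipD (V W : normedModType R) (F G : V -> W) :
  lip_on_balls F -> lip_on_balls G -> lip_on_balls (fun x => F x + G x).
Proof.
move=> Fl Gl r; have [L L0 FL] := Fl r; have [K K0 GK] := Gl r.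
exists (L + K); first exact: addr_ge0.
move=> x y xr yr; rewrite opprD addrACA mulrDl.
by rewrite (le_trans (ler_normD _ _))// lerD ?FL ?GK.
Qed.

Lemma lipN (V W : normedModType R) (F : V -> W) :
  lip_on_balls F -> lip_on_balls (fun x => - F x).
Proof.
move=> Fl r; have [L L0 FL] := Fl r; exists L => // x y xr yr.
by rewrite -opprD normrN FL.
Qed.

Lemma lipM (V : normedModType R) (F G : V -> R) :
  lip_on_balls F -> lip_on_balls G -> lip_on_balls (fun x => F x * G x).
Proof.
move=> Fl Gl r; have [L L0 FL] := Fl r; have [K K0 GK] := Gl r.
have [A A0 FA] := lip_bounded Fl r; have [B B0 GB] := lip_bounded Gl r.
exists (A * K + B * L); first by rewrite addr_ge0// mulr_ge0.
move=> x y xr yr.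
have -> : F x * G x - F y * G y = F x * (G x - G y) + G y * (F x - F y) by ring.
rewrite (le_trans (ler_normD _ _))// !normrM mulrDl -!mulrA.
by rewrite lerD// ler_pM ?FA ?GB ?FL ?GK.
Qed.

Lemma lip_sum (V W : normedModType R) (I : Type) (s : seq I) (P : pred I)
    (F : I -> V -> W) : (forall i, lip_on_balls (F i)) ->
  lip_on_balls (fun x => \sum_(i <- s | P i) F i x).
Proof.
move=> Fl; elim: s => [|i s IH].
  by under eq_fun do rewrite big_nil; exact: lip_cst.
under eq_fun do rewrite big_cons.
by case: (P i) => //; exact: lipD.
Qed.

Lemma lip_prod (V : normedModType R) (I : Type) (s : seq I) (P : pred I)
    (F : I -> V -> R) : (forall i, lip_on_balls (F i)) ->
  lip_on_balls (fun x => \prod_(i <- s | P i) F i x).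
Proof.
move=> Fl; elim: s => [|i s IH].
  by under eq_fun do rewrite big_nil; exact: lip_cst.
under eq_fun do rewrite big_cons.
by case: (P i) => //; exact: lipM.
Qed.

Lemma lipV n (F : 'rV[R]_n -> R) : (forall x, F x != 0) ->
  lip_on_balls F -> lip_on_balls (fun x => (F x)^-1).
Proof.
move=> F0 Fl r.
have cV : continuous (fun x => (F x)^-1).
  by move=> x; apply: (@continuousV _ 'rV[R]_n); [exact: F0|exact: (lip_continuous Fl)].
have [L L0 FL] := Fl r.
have [M M0 FM] := continuous_bounded_on_balls r cV.
exists (M * M * L); first by rewrite !mulr_ge0.
move=> x y xr yr.
have -> : (F x)^-1 - (F y)^-1 = - ((F x)^-1 * (F y)^-1 * (F x - F y)).
  by field; rewrite !F0.
rewrite normrN !normrM -[leRHS]mulrA.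
by rewrite ler_pM ?mulr_ge0// ?FL// ler_pM ?FM.
Qed.

Lemma lip_mxP (V : normedModType R) m n (F : V -> 'M[R]_(m, n)) :
  lip_on_balls F <-> forall i j, lip_on_balls (fun x => F x i j).
Proof.
split=> [Fl i j r|Fl r].
  have [L L0 FL] := Fl r; exists L => // x y xr yr.
  rewrite (le_trans _ (FL _ _ xr yr))//.
  by have := ler_coord_norm (F x - F y) i j; rewrite !mxE.
have /choice[L HL] : forall ij : 'I_m * 'I_n, exists L, 0 <= L /\
    forall x y, `|x| <= r -> `|y| <= r ->
    `|F x ij.1 ij.2 - F y ij.1 ij.2| <= L * `|x - y|.
  by move=> [i j]; have [L L0 FL] := Fl i j r; exists L.
have L0 ij : 0 <= L ij by have [] := HL ij.
exists (\sum_ij L ij); first by apply: sumr_ge0 => i _; exact: L0.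
move=> x y xr yr; apply: mx_norm_le => [|i j].
  by rewrite mulr_ge0// sumr_ge0.
rewrite !mxE; have [_ /(_ x y xr yr) /= FL] := HL (i, j).
rewrite (le_trans FL)// ler_wpM2r// (bigD1 (i, j))//= lerDl.
by rewrite sumr_ge0.
Qed.

Lemma lip_coord m n i j : lip_on_balls (fun x : 'M[R]_(m, n) => x i j).
Proof.
by apply: (lip_mxP (fun x : 'M[R]_(m, n) => x)).1 => r; exists 1 => // x y _ _; rewrite mul1r.
Qed.

Lemma lip_comp (U V W : normedModType R) (F : V -> W) (G : U -> V) :
  lip_on_balls F -> lip_on_balls G -> lip_on_balls (fun x => F (G x)).
Proof.
move=> Fl Gl r; have [K K0 GK] := Gl r; have [M M0 GM] := lip_bounded Gl r.
have [L L0 FL] := Fl M; exists (L * K); first exact: mulr_ge0.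
move=> x y xr yr; rewrite (le_trans (FL _ _ (GM _ xr) (GM _ yr)))//.
by rewrite -mulrA ler_wpM2l// GK.
Qed.

Lemma lip_mulmx (V : normedModType R) m n p (F : V -> 'M[R]_(m, n))
    (G : V -> 'M[R]_(n, p)) :
  lip_on_balls F -> lip_on_balls G -> lip_on_balls (fun x => F x *m G x).
Proof.
move=> /lip_mxP Fl /lip_mxP Gl; apply/lip_mxP => i j.
under eq_fun do rewrite mxE.
by apply: lip_sum => k; exact: lipM.
Qed.

Lemma lip_det (V : normedModType R) n (F : V -> 'M[R]_n) :
  lip_on_balls F -> lip_on_balls (fun x => \det (F x)).
Proof.
move=> /lip_mxP Fl; rewrite /determinant; apply: lip_sum => s; apply: lipM; first exact: lip_cst.
by apply: lip_prod => i.
Qed.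

(** By Cramer's rule the entries of the inverse are polynomials in the entries divided
by a determinant that does not vanish. *)
Lemma lip_invmx N n (F : 'rV[R]_N -> 'M[R]_n) :
  (forall x, F x \in unitmx) ->
  lip_on_balls F -> lip_on_balls (fun x => invmx (F x)).
Proof.
move=> Fu Fl; apply/lip_mxP => i j.
under eq_fun do rewrite /invmx Fu !mxE.
apply: lipM.
  apply: lipV; last exact: lip_det.
  by move=> x; have := Fu x; rewrite unitmxE unitfE.
rewrite /cofactor; apply: lipM; first exact: lip_cst.
apply: lip_det; apply/lip_mxP => k l; under eq_fun do rewrite !mxE.
exact: ((lip_mxP F).1 Fl).
Qed.

Lemma segment_norm_le (V : normedModType R) (x y : V) r t : `|x| <= r -> `|y| <= r ->
  0 <= t <= 1 -> `|x + t *: (y - x)| <= r.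
Proof.
move=> xr yr /andP[t0 t1].
have -> : x + t *: (y - x) = (1 - t) *: x + t *: y.
  by rewrite scalerBr scalerBl scale1r addrCA addrC.
rewrite (le_trans (ler_normD _ _))// !normrZ ger0_norm ?subr_ge0//.
rewrite (ger0_norm t0).
have -> : r = (1 - t) * r + t * r by ring.
by rewrite lerD// ler_wpM2l// subr_ge0.
Qed.

Lemma is_derive_line (V : normedModType R) (x v : V) (t : R) :
  is_derive t 1 (fun t : R => x + t *: v) v.
Proof.
rewrite -[X in is_derive _ _ _ X]add0r; apply: is_deriveD.
have dv : differentiable (fun t : R => t *: v) t.
  exact: differentiableZl.
apply: DeriveDef; first exact/derivable1_diffP.
by rewrite deriveE// diffZl// diff_val scale1r.
Qed.

Lemma MVT_line n (F : 'rV[R]_n -> R) x y : (forall x, differentiable F x) ->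
  exists2 t, 0 <= t <= 1 & F y - F x = 'D_(y - x) F (x + t *: (y - x)).
Proof.
move=> dF.
pose g (t : R) := F (x + t *: (y - x)).
have dg (t : R) : is_derive t (1 : R) g ('D_(y - x) F (x + t *: (y - x))).
  by apply: is_derive_comp1 => //; exact: is_derive_line.
have cg : {within `[(0 : R), 1], continuous g}.
  apply: continuous_subspaceT => t; apply: differentiable_continuous.
  by apply/derivable1_diffP; have [] := dg t.
have [t] := MVT_segment ler01 (fun t _ => dg t) cg.
rewrite in_itv/= => t01 gE; exists t => //.
by move: gE; rewrite /g scale1r scale0r addr0 [x + (y - x)]addrC subrK subr0 mulr1.
Qed.

(** Mean value theorem on segments: balls are convex, and the partial derivatives are
bounded on the compact ball. *)
Lemma C1_lip n (F : 'rV[R]_n -> R) : Ck 1 F -> lip_on_balls F.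
Proof.
move=> [dF cF] r.
have /choice[M HM] : forall i : 'I_n, exists M, 0 <= M /\
    forall x, `|x| <= r -> `|'D_(delta_mx 0 i) F x| <= M.
  move=> i; have [M M0 FM] := continuous_bounded_on_balls r (cF (delta_mx 0 i)).
  by exists M.
exists (\sum_i M i); first by apply: sumr_ge0 => i _; have [] := HM i.
move=> y x yr xr; have [t t01 ->] := MVT_line x y dF.
rewrite derive_coord// (le_trans (ler_norm_sum _ _ _))// mulr_suml.
apply: ler_sum => i _; have [_ Mi] := HM i.
rewrite normrM mulrC ler_pM//; first by apply: Mi; exact: segment_norm_le.
exact: ler_coord_norm.
Qed.

(** The mean value theorem replaces the increment by a derivative at an intermediate
point, and C1_lip bounds the change of the derivative up to that point. *)
Lemma C2_taylor n (F : 'rV[R]_n -> R) : Ck 2 F -> forall r,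
  exists2 K, 0 <= K & forall x v, `|x| <= r -> `|x + v| <= r ->
    `|F (x + v) - F x - 'D_v F x| <= K * `|v| ^+ 2.
Proof.
move=> [dF cF] r.
have /choice[M HM] : forall i : 'I_n, exists M, 0 <= M /\
    forall x y, `|x| <= r -> `|y| <= r ->
    `|'D_(delta_mx 0 i) F x - 'D_(delta_mx 0 i) F y| <= M * `|x - y|.
  move=> i; have [M M0 FM] := C1_lip (cF (delta_mx 0 i)) r.
  by exists M.
have M0 i : 0 <= M i by have [] := HM i.
exists (\sum_i M i); first by apply: sumr_ge0 => i _; exact: M0.
move=> x v xr xvr; have [t t01] := MVT_line x (x + v) dF.
have -> : x + v - x = v by rewrite addrC addKr.
move=> ->.
rewrite !(derive_coord v)// -sumrB (le_trans (ler_norm_sum _ _ _))// mulr_suml.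
apply: ler_sum => i _; have [_ Mi] := HM i.
rewrite -scalerBr normrM expr2 mulrC mulrA ler_pM//; last exact: ler_coord_norm.
have vE : v = x + v - x by rewrite addrC addKr.
rewrite (le_trans (Mi _ _ _ xr))//; first by rewrite {1}vE segment_norm_le.
rewrite ler_wpM2l// addrC addKr normrZ ler_piMl//.
by case/andP: t01 => t0 t1; rewrite ger0_norm.
Qed.

End lipschitz.

(** * Gronwall estimates and continuous dependence *)

Section ode_lemmas.
Context {R : realType}.

Lemma is_derive_continuous (V : normedModType R) (u : R -> V) (t : R) d :
  is_derive t (1 : R) u d -> {for t, continuous u}.
Proof.
by move=> [du _]; apply: differentiable_continuous; exact/derivable1_diffP.
Qed.

Lemma is_derive_congr (V W : normedModType R) (f f' : V -> W) x v df df' :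
  is_derive x v f df -> f =1 f' -> df = df' -> is_derive x v f' df'.
Proof. by move=> h /funext <- <-. Qed.

Lemma is_derive_expRM (K s : R) :
  is_derive s (1 : R) (fun s => expR (K * s)) (K * expR (K * s)).
Proof.
have H : is_derive s (1 : R) (fun s => K * s) K.
  apply: is_derive_congr (is_deriveZ K (is_derive_id s (1 : R))) _ _ => //.
  by rewrite [LHS]mulr1.
apply: is_derive_congr (is_derive1_comp (is_derive_expR _) H) _ _ => //.
by rewrite mulrC.
Qed.

(** Continuous induction: the infimum of the times at which the bound fails would be a
time up to which it holds, hence one at which it still holds strictly. It
turns estimates valid as long as a solution stays in a tube into the fact that the
solution does stay there. *)
Lemma first_exit (phi : R -> R) (T c : R) :
  (forall t, 0 <= t <= T -> {for t, continuous phi}) ->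
  (forall t, 0 <= t <= T -> (forall s, 0 <= s < t -> phi s < c) -> phi t < c) ->
  forall t, 0 <= t <= T -> phi t < c.
Proof.
move=> cphi step t1 t1T; rewrite ltNge; apply/negP => ct1.
pose A := [set t | 0 <= t <= T /\ c <= phi t].
have At1 : A t1 by [].
have lbA : lbound A 0 by move=> t [/andP[]].
have infA : has_inf A by split; [exists t1|exists 0].
pose m := inf A.
have m0 : 0 <= m by apply: lb_le_inf => //; exists t1.
have mA t : A t -> m <= t by apply: ge_inf; exists 0.
have mT : 0 <= m <= T.
  by rewrite m0 (le_trans (mA _ At1))//; case/andP: t1T.
have phim : phi m < c.
  apply: step => // s /andP[s0 sm]; rewrite ltNge; apply/negP => cs.
  suff : m <= s by rewrite leNgt sm.
  apply: mA; split => //; rewrite s0 (le_trans (ltW sm))//.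
  by case/andP: mT.
have : \forall s \near m, phi s < c by apply: (cvgr_lt _ (cphi m mT)).
move=> /nbhs_ballP[e /= e0 me].
have [a Aa ame] := inf_adherent e0 infA.
have [_] := Aa; rewrite leNgt => /negP; apply; apply: me.
rewrite /ball/= distrC ger0_norm ?subr_ge0 ?mA//.
by rewrite ltrBlDl.
Qed.

Lemma mvt_norm_oo m n (u du : R -> 'M[R]_(m, n)) (a b M : R) :
  a <= b -> {within `[a, b], continuous u} ->
  (forall t : R, a < t < b -> is_derive t (1 : R) u (du t)) ->
  (forall t, a < t < b -> `|du t| <= M) -> 0 <= M ->
  `|u b - u a| <= M * (b - a).
Proof.
move=> ab cu dut duM M0; apply: mx_norm_le => [|i j].
  by rewrite mulr_ge0// subr_ge0.
move: ab; rewrite le_eqVlt => /predU1P[->|ab].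
  by rewrite !subrr !mulr0 mxE normr0.
have cuij : {within `[a, b], continuous (fun t => u t i j)}.
  move=> t.
  apply: (@continuous_comp (subspace `[a, b]) _ _ u (fun A : 'M[R]_(m, n) => A i j)).
    exact: cu.
  exact: coord_continuous.
have duij t : t \in `]a, b[%R -> is_derive t (1 : R) (fun t => u t i j) (du t i j).
  by rewrite in_itv/= => tab; have /is_derive_mxP := dut t tab; exact.
have [t] := MVT ab duij cuij.
rewrite in_itv/= => tab uE; rewrite !mxE uE normrM.
have ba0 : 0 <= b - a by rewrite subr_ge0 ltW.
rewrite (ger0_norm ba0) ler_wpM2r//.
by rewrite (le_trans (ler_coord_norm _ _ _))// duM.
Qed.

Lemma mvt_norm m n (u du : R -> 'M[R]_(m, n)) (a b M : R) :
  a <= b -> (forall t : R, a <= t <= b -> is_derive t (1 : R) u (du t)) ->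
  (forall t, a < t < b -> `|du t| <= M) -> 0 <= M ->
  `|u b - u a| <= M * (b - a).
Proof.
move=> ab dut; apply: mvt_norm_oo => //.
  apply: derivable_within_continuous => t; rewrite in_itv/= => /dut[].
  by [].
by move=> t /andP[/ltW at_ /ltW tb]; apply: dut; rewrite at_.
Qed.

Lemma cvg_shift0 (t : R) : (h + t) @[h --> (0 : R)] --> t.
Proof.
rewrite -{2}[t]add0r.
apply: (@cvgD R R R^o (nbhs (0 : R)) _ id (cst t) 0 t); last exact: cvg_cst.
exact: cvg_id.
Qed.

(** A limit of solutions is known through inequalities only; a quadratic Taylor
inequality passes to the limit and gives back the derivative. *)
Lemma is_derive_of_taylor (V : normedModType R) (u : R -> V) (t : R) d K :
  (\forall s \near t, `|u s - u t - (s - t) *: d| <= K * (s - t) ^+ 2) ->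
  is_derive t (1 : R) u d.
Proof.
move=> uK.
have cv : (h^-1 *: (u (h *: 1 + t) - u t)) @[h --> 0^'] --> d.
  apply/cvgrPdist_le => e e0.
  near=> h.
  have h0 : h != 0 by near: h; exact: nbhs_dnbhs_neq.
  have -> : d - h^-1 *: (u (h *: 1 + t) - u t) =
     - (h^-1 *: (u (h *: 1 + t) - u t - ((h *: 1 + t) - t) *: d)).
    by rewrite [h%:A]mulr1 addrK (scalerBr _ _ (h *: d)) scalerA mulVf// scale1r [RHS]opprB.
  rewrite normrN normrZ normfV ler_pdivrMl ?normr_gt0//.
  have hK : `|u (h *: 1 + t) - u t - (h *: 1 + t - t) *: d| <=
      K * (h *: 1 + t - t) ^+ 2.
    near: h; apply: nbhs_dnbhs.
    have H : \forall h \near (0 : R), `|u (h + t) - u t - (h + t - t) *: d| <=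
      K * (h + t - t) ^+ 2 := @cvg_shift0 t _ uK.
    by apply: filterS H => y; rewrite [y%:A]mulr1.
  rewrite (le_trans hK)// [h *: 1]mulr1 addrK.
  rewrite -[h ^+ 2]real_normK ?num_real// expr2 mulrA [leRHS]mulrC ler_wpM2r//.
  apply: (@le_trans _ _ ((`|K| + 1) * `|h|)).
    by rewrite ler_wpM2r// (le_trans (ler_norm _)) ?lerDl.
  rewrite -ler_pdivlMl; last by rewrite ltr_wpDl.
  near: h; apply: dnbhs0_le.
  by rewrite mulr_gt0// invr_gt0 ltr_wpDl.
by apply: DeriveDef; [apply/cvg_ex; exists d|exact/cvg_lim].
Unshelve. all: by end_near. Qed.

Lemma sqdist_ge0 n (x y : 'rV[R]_n) : 0 <= sqdist x y.
Proof. by apply: sumr_ge0 => i _; exact: sqr_ge0. Qed.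

(** The norm on row vectors is the maximum norm, which is not differentiable. Gronwall
is therefore run on the sum of squares, which is equivalent to the squared norm. *)
Lemma norm_le_sqdist n (x y : 'rV[R]_n) : `|x - y| ^+ 2 <= sqdist x y.
Proof.
rewrite -[leRHS]sqr_sqrtr ?sqdist_ge0// lerXn2r ?nnegrE ?sqrtr_ge0//.
apply: mx_norm_le => [|i j]; first exact: sqrtr_ge0.
rewrite !mxE ord1 -sqrtr_sqr; apply: ler_wsqrtr.
rewrite /sqdist (bigD1 j)//= lerDl.
by apply: sumr_ge0 => k _; exact: sqr_ge0.
Qed.

Lemma sqdist_le_norm n (x y : 'rV[R]_n) : sqdist x y <= n%:R * `|x - y| ^+ 2.
Proof.
rewrite (@le_trans _ _ (\sum_(i < n) `|x - y| ^+ 2))//.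
  apply: ler_sum => i _; rewrite -[leLHS]real_normK ?num_real// lerXn2r ?nnegrE//.
  by have := ler_coord_norm (x - y) 0 i; rewrite !mxE.
by rewrite sumr_const card_ord mulr_natl.
Qed.

(** The squared distance multiplied by the decreasing exponential has a nonpositive
derivative: by the Lipschitz bound each of the n coordinates contributes at most
2 L |u - w|^2 to the derivative of the squared distance. *)
Lemma gronwall n (g : 'rV[R]_n -> 'rV[R]_n) (r L : R) (u w : R -> 'rV[R]_n) (t : R) :
  0 <= L -> (forall x y, `|x| <= r -> `|y| <= r -> `|g x - g y| <= L * `|x - y|) ->
  0 <= t ->
  (forall s : R, 0 <= s <= t -> is_derive s (1 : R) u (g (u s))) ->
  (forall s : R, 0 <= s <= t -> is_derive s (1 : R) w (g (w s))) ->
  (forall s : R, 0 < s < t -> `|u s| <= r /\ `|w s| <= r) ->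
  sqdist (u t) (w t) <= sqdist (u 0) (w 0) * expR (n%:R * 2 * L * t).
Proof.
move=> L0 gL t0 du dw uwr.
move: t0; rewrite le_eqVlt => /predU1P[<-|t0].
  by rewrite mulr0 expR0 mulr1.
pose K := n%:R * 2 * L.
pose e (s : R) := expR (- K * s).
have de s : is_derive s (1 : R) e (- K * e s) by exact: is_derive_expRM.
pose dphi s := \sum_i 2 * (u s 0 i - w s 0 i) * (g (u s) 0 i - g (w s) 0 i).
have dphiP s : 0 <= s <= t ->
    is_derive s (1 : R) (fun s => sqdist (u s) (w s)) (dphi s).
  move=> st.
  have -> : (fun s => sqdist (u s) (w s)) = \sum_i (fun s => (u s 0 i - w s 0 i) ^+ 2).
    by apply/funext => x; rewrite fct_sumE.
  apply: is_derive_sum => i.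
  have /is_derive_mxP/(_ 0 i) dui := du s st.
  have /is_derive_mxP/(_ 0 i) dwi := dw s st.
  have dd := is_deriveB dui dwi.
  apply: is_derive_congr (is_deriveX 2 dd) _ _ => //.
pose psi s := sqdist (u s) (w s) * e s.
have dpsi s : 0 <= s <= t ->
    is_derive s (1 : R) psi (dphi s * e s + sqdist (u s) (w s) * (- K * e s)).
  move=> st.
  apply: is_derive_congr (is_deriveM (dphiP s st) (de s)) _ _ => //.
  by rewrite /GRing.scale/=; ring.
have cpsi : {within `[0, t], continuous psi}.
  apply: derivable_within_continuous => s; rewrite in_itv/= => /dpsi[].
  by [].
have dpsi' s : s \in `]0, t[%R ->
    is_derive s (1 : R) psi (dphi s * e s + sqdist (u s) (w s) * (- K * e s)).
  by rewrite in_itv/= => /andP[/ltW s0 /ltW st]; apply: dpsi; rewrite s0.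
have [s] := MVT t0 dpsi' cpsi.
rewrite in_itv/= => st psiE.
have psi_le : psi t <= psi 0.
  rewrite -subr_le0 psiE subr0 pmulr_lle0//.
  have -> : dphi s * e s + sqdist (u s) (w s) * (- K * e s) =
    e s * (dphi s - K * sqdist (u s) (w s)) by ring.
  rewrite pmulr_rle0 ?expR_gt0// subr_le0.
  apply: (@le_trans _ _ (K * `|u s - w s| ^+ 2)); last first.
    rewrite ler_wpM2l ?norm_le_sqdist//.
    by rewrite !mulr_ge0.
  apply: (@le_trans _ _ (\sum_(i < n) 2 * L * `|u s - w s| ^+ 2)); last first.
    by rewrite sumr_const card_ord -[leLHS]mulr_natl /K !mulrA.
  apply: ler_sum => i _.
  have [ur wr] := uwr s st.
  rewrite (le_trans (ler_norm _))// !normrM ger0_norm// expr2.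
  have -> : 2 * L * (`|u s - w s| * `|u s - w s|) =
    2 * `|u s - w s| * (L * `|u s - w s|) by ring.
  rewrite ler_pM ?mulr_ge0 ?ler_wpM2l//.
    by have := ler_coord_norm (u s - w s) 0 i; rewrite !mxE.
  rewrite (le_trans _ (gL _ _ ur wr))//.
  by have := ler_coord_norm (g (u s) - g (w s)) 0 i; rewrite !mxE.
move: psi_le; rewrite /psi /e mulr0 expR0 mulr1 => psi_le.
by rewrite -ler_pdivrMr ?expR_gt0// -expRN -mulNr.
Qed.

Lemma cvg_sumr (T : Type) (F : set_system T) (W : normedModType R) (I : Type)
    (s : seq I) (f : I -> T -> W) (l : I -> W) : Filter F ->
  (forall i, f i x @[x --> F] --> l i) ->
  (\sum_(i <- s) f i x) @[x --> F] --> \sum_(i <- s) l i.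
Proof.
move=> FF fl; elim: s => [|i s IH].
  by under eq_fun do rewrite big_nil; rewrite big_nil; exact: cvg_cst.
under eq_fun do rewrite big_cons; rewrite big_cons.
exact: cvgD.
Qed.

Definition solves n (g : 'rV[R]_n -> 'rV[R]_n) (u : R -> 'rV[R]_n) :=
  forall t : R, is_derive t (1 : R) u (g (u t)).

Lemma solves_continuous n (g : 'rV[R]_n -> 'rV[R]_n) u :
  solves g u -> continuous u.
Proof. by move=> gu t; exact: is_derive_continuous (gu t). Qed.

Lemma sqdist_continuous n (u w : R -> 'rV[R]_n) (t : R) :
  continuous u -> continuous w ->
  {for t, continuous (fun s => sqdist (u s) (w s))}.
Proof.
move=> cu cw; rewrite /sqdist.
apply: cvg_sumr => i.
have cdu : (u s 0 i - w s 0 i) @[s --> t] --> u t 0 i - w t 0 i.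
  apply: cvgB.
    apply: (@continuous_comp _ _ _ u (fun x : 'rV[R]_n => x 0 i)); first exact: cu.
    exact: coord_continuous.
  apply: (@continuous_comp _ _ _ w (fun x : 'rV[R]_n => x 0 i)); first exact: cw.
    exact: coord_continuous.
exact: (cvgM cdu cdu).
Qed.

Lemma curve_bounded n (u : R -> 'rV[R]_n) (a b : R) : continuous u ->
  exists2 r, 0 <= r & forall t, a <= t <= b -> `|u t| <= r.
Proof.
move=> cu; have [ab|ba] := leP a b; last first.
  exists 0 => // t /andP[at_ tb].
  by have := lt_le_trans ba (le_trans at_ tb); rewrite ltxx.
have cn : {within `[a, b], continuous (fun t => `|u t|)}.
  by apply: continuous_subspaceT => t; apply: continuous_comp; [exact: cu|exact: norm_continuous].
have [c _ uc] := EVT_max ab cn.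
by exists `|u c| => // t tab; apply: uc; rewrite in_itv.
Qed.

(** A tube of radius 1 around the compact piece u([0, T]) is bounded, so the
field is Lipschitz there; Gronwall holds while w is in the tube, and a small initial
distance prevents w from leaving it. *)
Lemma continuous_dependence n (g : 'rV[R]_n -> 'rV[R]_n) u T :
  lip_on_balls g -> solves g u -> 0 <= T ->
  exists A, exists d, [/\ 0 < A, 0 < d &
    forall w, solves g w -> `|w 0 - u 0| < d ->
    forall t, 0 <= t <= T -> `|w t - u t| <= A * `|w 0 - u 0|].
Proof.
move=> gl gu T0; have cu := solves_continuous gu.
have [r r0 ur] := curve_bounded 0 T cu.
have [L L0 gL] := gl (r + 1).
pose K := n%:R * 2 * L.
have K0 : 0 <= K by rewrite !mulr_ge0.
(* The summand 1 makes A at least 1, also when n = 0, so that A bounds its own square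
   root. *)
pose A := (n%:R + 1) * expR (K * T).
have e1 : 1 <= expR (K * T) by rewrite -expR0 ler_expR mulr_ge0.
have A1 : 1 <= A by rewrite -[leLHS]mulr1 ler_pM// lerDr.
have A0 : 0 < A := lt_le_trans ltr01 A1.
exists A, A^-1; split => //; first by rewrite invr_gt0.
move=> w gw w0; have cw := solves_continuous gw.
have ebound t : 0 <= t <= T -> sqdist (w 0) (u 0) * expR (K * t) <=
    A * `|w 0 - u 0| ^+ 2.
  move=> /andP[t0 tT]; rewrite /A [leRHS]mulrAC ler_pM ?sqdist_ge0 ?expR_ge0//.
    by rewrite (le_trans (sqdist_le_norm _ _))// ler_wpM2r ?exprn_ge0// lerDl.
  by rewrite ler_expR ler_wpM2l.
have phi1 t : 0 <= t <= T -> sqdist (w t) (u t) < 1.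
  apply: (@first_exit (fun s => sqdist (w s) (u s)) T 1) => [s _|s sT IH].
    exact: sqdist_continuous.
  have [s0 sT'] := andP sT.
  apply: (@le_lt_trans _ _ (sqdist (w 0) (u 0) * expR (K * s))).
    apply: (@gronwall n g (r + 1) L) => // x /andP[x0 xs].
    have uxr : `|u x| <= r by apply: ur; rewrite ltW//= (le_trans (ltW xs)).
    split; last by rewrite (le_trans uxr)// lerDl.
    rewrite -[w x](subrK (u x)) addrC (le_trans (ler_normD _ _))// lerD//.
    rewrite -(@ler_pXn2r _ 2)// ?nnegrE// expr1n ltW//.
    rewrite (le_lt_trans (norm_le_sqdist _ _))// IH//.
    by rewrite ltW.
  rewrite (le_lt_trans (ebound _ sT))//.
  apply: (@le_lt_trans _ _ (A * (A^-1 * `|w 0 - u 0|))).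
    by rewrite ler_pM2l// expr2 ler_wpM2r// ltW.
  rewrite mulrA divff ?gt_eqF// mul1r (lt_le_trans w0)// invf_le1//.
move=> t tT; have [t0 tT'] := andP tT.
have A0' := ltW A0.
rewrite -(@ler_pXn2r _ 2)// ?nnegrE ?mulr_ge0//.
rewrite (le_trans (norm_le_sqdist _ _))//.
apply: (@le_trans _ _ (sqdist (w 0) (u 0) * expR (K * t))).
  apply: (@gronwall n g (r + 1) L) => // x /andP[x0 xs].
  have xT : 0 <= x <= T by rewrite ltW//= (le_trans (ltW xs)).
  have uxr : `|u x| <= r by apply: ur.
  split; last by rewrite (le_trans uxr)// lerDl.
  rewrite -[w x](subrK (u x)) addrC (le_trans (ler_normD _ _))// lerD//.
  rewrite -(@ler_pXn2r _ 2)// ?nnegrE// expr1n ltW//.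
  by rewrite (le_lt_trans (norm_le_sqdist _ _))// phi1.
rewrite (le_trans (ebound _ tT))// exprMn ler_wpM2r ?exprn_ge0//.
by rewrite expr2 ler_peMl.
Qed.

End ode_lemmas.

(** * Limits of solutions of differential equations *)

Section limits.
Context {R : realType}.

(** The field is bounded on the larger ball, and moving by 1 takes a time bounded below. *)
Lemma solves_stay n (g : 'rV[R]_n -> 'rV[R]_n) (r : R) : lip_on_balls g ->
  exists2 tau, 0 < tau & forall u, solves g u -> `|u 0| < r ->
    forall t, 0 <= t <= tau -> `|u t| < r + 1.
Proof.
move=> gl; have [M M0 gM] := lip_bounded gl (r + 1).
have M1 : 0 < M + 1 by rewrite ltr_wpDl.
exists (M + 1)^-1; first by rewrite invr_gt0.
move=> u gu u0.
apply: (@first_exit _ (fun t => `|u t|) (M + 1)^-1 (r + 1)) => [t _|t].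
  apply: (@continuous_comp _ _ _ u (fun x : 'rV[R]_n => `|x|)).
    exact: solves_continuous gu _.
  exact: norm_continuous.
move=> /andP[t0 tM] IH.
rewrite -[u t](subrK (u 0)) addrC (le_lt_trans (ler_normD _ _))// ltr_leD//.
have H : `|u t - u 0| <= M * (t - 0).
  apply: (@mvt_norm _ _ _ u (fun t => g (u t))) => //.
  by move=> s /andP[s0 st]; apply/gM/ltW/IH; rewrite ltW.
rewrite (le_trans H)// subr0 (@le_trans _ _ (M * (M + 1)^-1)) ?ler_wpM2l//.
by rewrite ler_pdivrMr// mul1r lerDl.
Qed.

Lemma solves_rev n (g : 'rV[R]_n -> 'rV[R]_n) u :
  solves g u -> solves (fun x => - g x) (fun t => u (- t)).
Proof.
move=> gu t.
have dN : is_derive t (1 : R) (fun t : R => - t) (- 1).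
  exact: is_derive_congr (is_deriveN (is_derive_id t (1 : R))) _ _.
have [du due] := gu (- t).
have dfu : differentiable u (- t) by exact/derivable1_diffP.
have := is_derive_comp1 (g := fun t => - t) dfu dN.
move=> h; apply: (is_derive_congr h) => //.
by rewrite -due !deriveE// linearN.
Qed.

(** A time interval and a Lipschitz constant that are uniform over all solutions starting
in a ball; both are needed to pass to the limit in the initial condition. *)
Lemma local_flow n (g : 'rV[R]_n -> 'rV[R]_n) (r : R) : lip_on_balls g ->
  exists tau, exists A, [/\ 0 < tau, 0 <= A &
    forall u w, solves g u -> solves g w -> `|u 0| < r -> `|w 0| < r ->
    forall t, `|t| <= tau -> `|u t| <= r + 1 /\ `|u t - w t| <= A * `|u 0 - w 0|].
Proof.
move=> gl; have gNl : lip_on_balls (fun x => - g x) by exact: lipN.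
have [tau tau0 st] := solves_stay r gl.
have [tau' tau'0 st'] := solves_stay r gNl.
have [L L0 gL] := gl (r + 1).
pose T := Num.min tau tau'.
have T0 : 0 < T by rewrite lt_min tau0.
pose E := expR (n%:R * 2 * L * T).
have E0 : 0 < E by exact: expR_gt0.
pose A := Num.sqrt (n%:R * E).
exists T, A; split => //; first exact: sqrtr_ge0.
(* Negative times are positive times of the reversed field, so the estimate is
   first proved forwards for an arbitrary field. *)
have main (f : 'rV[R]_n -> 'rV[R]_n) u w : solves f u -> solves f w ->
    `|u 0| < r -> `|w 0| < r ->
    (forall x y, `|x| <= r + 1 -> `|y| <= r + 1 -> `|f x - f y| <= L * `|x - y|) ->
    (forall t, 0 <= t <= T -> `|u t| < r + 1) ->
    (forall t, 0 <= t <= T -> `|w t| < r + 1) ->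
    forall t, 0 <= t <= T -> `|u t - w t| <= A * `|u 0 - w 0|.
  move=> fu fw u0 w0 fL ur wr t /andP[t0 tT].
  rewrite -(@ler_pXn2r _ 2)// ?nnegrE ?mulr_ge0 ?sqrtr_ge0//.
  rewrite (le_trans (norm_le_sqdist _ _))//.
  have := @gronwall R n f (r + 1) L u w t L0 fL t0 (fun s _ => fu s) (fun s _ => fw s).
  move=> /(_ _)/le_trans; apply.
    by move=> s /andP[/ltW s0 /ltW st1]; split; apply: ltW;
       [apply: ur|apply: wr]; rewrite s0 (le_trans st1).
  rewrite exprMn sqr_sqrtr ?mulr_ge0 ?expR_ge0// [leRHS]mulrAC.
  rewrite ler_pM ?sqdist_ge0 ?expR_ge0 ?sqdist_le_norm//.
  by rewrite ler_expR ler_wpM2l// !mulr_ge0.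
have st1 u : solves g u -> `|u 0| < r -> forall t, 0 <= t <= T -> `|u t| < r + 1.
  move=> gu u0 t /andP[t0 tT]; apply: st => //; rewrite t0 (le_trans tT)//.
  by rewrite ge_min lexx.
have st2 u : solves g u -> `|u 0| < r -> forall t, 0 <= t <= T -> `|u (- t)| < r + 1.
  move=> gu u0 t /andP[t0 tT].
  apply: (st' _ (solves_rev gu)); first by rewrite oppr0.
  by rewrite t0 (le_trans tT)// ge_min lexx orbT.
move=> u w gu gw u0 w0 t; rewrite ler_norml => /andP[tl tr].
have [t0|t0] := leP 0 t.
  have tT : 0 <= t <= T by rewrite t0.
  split; first by apply/ltW/st1.
  by apply: (main g) => // s sT; apply: st1.
have tT : 0 <= - t <= T by rewrite oppr_ge0 ltW//= lerNl.
split; first by rewrite -[t]opprK; apply/ltW/st2.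
have := main (fun x => - g x) (fun t => u (- t)) (fun t => w (- t))
  (solves_rev gu) (solves_rev gw).
rewrite oppr0 => /(_ u0 w0) H; rewrite -[t]opprK; apply: H => //.
- by move=> x y xr yr; rewrite -opprD normrN gL.
- exact: st2.
- exact: st2.
Qed.

(** Near z0 the solutions U z are uniformly close to one another on a common time
interval, so U z t is Cauchy as z tends to z0 within D. The quadratic Taylor
estimate holds with constants that do not depend on z, hence it holds for the limit,
which therefore solves the equation. *)
Lemma limit_solution n (g : 'rV[R]_n -> 'rV[R]_n) (D : set 'rV[R]_n)
    (U : 'rV[R]_n -> R -> 'rV[R]_n) (Q : set 'rV[R]_n) z0 :
  lip_on_balls g -> (forall z, D z -> U z 0 = z /\ solves g (U z)) ->
  closed Q -> (forall z, D z -> forall t, Q (U z t)) ->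
  closure D z0 ->
  exists tau u, [/\ 0 < tau, u 0 = z0 &
    forall t : R, `|t| < tau -> is_derive t (1 : R) u (g (u t)) /\ Q (u t)].
Proof.
move=> gl DU Qc DQ z0D.
have [tau [A [tau0 A0 flow]]] := local_flow (`|z0| + 1) gl.
have [L L0 gL] := gl (`|z0| + 1 + 1).
have [M M0 gM] := lip_bounded gl (`|z0| + 1 + 1).
pose F := within D (nbhs z0).
have FF : ProperFilter F by exact: within_nbhs_proper.
have Fnear (e : R) : 0 < e -> \forall z \near F, D z /\ `|z - z0| < e.
  move=> e0; change (\forall z \near z0, D z -> D z /\ `|z - z0| < e).
  have : \forall z \near z0, `|z0 - z| < e.
    by apply/nbhs_ballP; exists e => //= z; rewrite -ball_normE.
  by apply: filterS => z zz Dz; split => //; rewrite distrC.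
have Fr : \forall z \near F, D z /\ `|U z 0| < `|z0| + 1.
  apply: filterS (Fnear 1 ltr01) => z [Dz zz0]; split => //.
  have [-> _] := DU z Dz.
  rewrite -[z](subrK z0) addrC (le_lt_trans (ler_normD _ _))// ltrD2l//.
have Ucvg (t : R) : `|t| <= tau -> cvg (U z t @[z --> F]).
  move=> tt; apply: cauchy_cvg; apply/cauchyP => e e0.
  have A1 : 0 < A + 1 by rewrite ltr_wpDl.
  have e1 : 0 < e / (A + 1) / 2 by rewrite !divr_gt0.
  have Fe : \forall z \near F, (D z /\ `|z - z0| < e / (A + 1) / 2) /\
      (D z /\ `|U z 0| < `|z0| + 1).
    by apply: filterI; [exact: Fnear|exact: Fr].
  have [z1 [[Dz1 z10] [_ z1r]]] := filter_ex Fe.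
  exists (U z1 t).
  apply: filterS Fe => z [[Dz zz0] [_ zr]].
  rewrite /= -ball_normE/=.
  have [Uz1 gz1] := DU _ Dz1; have [Uz gz] := DU _ Dz.
  have [_] := flow _ _ gz1 gz z1r zr t tt.
  rewrite Uz1 Uz => /le_lt_trans; apply.
  apply: (@le_lt_trans _ _ ((A + 1) * `|z1 - z|)).
    by rewrite ler_wpM2r// lerDl.
  rewrite -ltr_pdivlMl// mulrC (splitr (_ / _)).
  rewrite -[z1 - z](subrKA z0) (le_lt_trans (ler_normD _ _))// ltrD//.
  by rewrite distrC.
pose u (t : R) := lim (U z t @[z --> F]).
have Uu (t : R) : `|t| <= tau -> U z t @[z --> F] --> u t by exact: Ucvg.
have cg := lip_continuous gl.
have taylor (s t : R) : `|s| <= tau -> `|t| <= tau ->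
    `|u s - u t - (s - t) *: g (u t)| <= L * M * (s - t) ^+ 2.
  move=> stau ttau.
  have cv : (U z s - U z t - (s - t) *: g (U z t)) @[z --> F] -->
      u s - u t - (s - t) *: g (u t).
    apply: cvgB; first by apply: cvgB; exact: Uu.
    apply: cvgZ; first exact: cvg_cst.
    exact: (cvg_comp _ _ (Uu t ttau) (cg (u t))).
  have := closed_cvg (fun x : 'rV[R]_n => `|x| <= L * M * (s - t) ^+ 2) _ _ _ cv.
  apply.
    apply: (@preimage_closed _ _ (fun x : 'rV[R]_n => `|x|)
      [set y : R | y <= L * M * (s - t) ^+ 2]).
      by move=> x _; exact: norm_continuous.
    exact: closed_le.
  apply: filterS Fr => z [Dz zr].
  have [Uz gz] := DU _ Dz.
  have Ur (x : R) : `|x| <= tau -> `|U z x| <= `|z0| + 1 + 1.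
    by move=> xt; have [] := flow _ _ gz gz zr zr x xt.
  have lipU (x y : R) : `|x| <= tau -> `|y| <= tau -> x <= y ->
      `|U z y - U z x| <= M * (y - x).
    rewrite !ler_norml => /andP[xl xr] /andP[yl yr] xy.
    apply: (@mvt_norm _ _ _ (U z) (fun t => g (U z t))) => // v /andP[xv vy].
    apply/gM/Ur; rewrite ler_norml (le_trans xl (ltW xv))/=.
    exact: le_trans (ltW vy) yr.
  have lipU' (x y : R) : `|x| <= tau -> `|y| <= tau ->
      `|U z y - U z x| <= M * `|y - x|.
    move=> xt yt; have [xy|/ltW xy] := leP x y.
      by rewrite (ger0_norm (_ : 0 <= y - x)) ?subr_ge0// lipU.
    by rewrite distrC [`|y - x|]distrC (ger0_norm (_ : 0 <= x - y)) ?subr_ge0// lipU.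
  pose v (x : R) := U z x - x *: g (U z t).
  have dv (x : R) : is_derive x (1 : R) v (g (U z x) - g (U z t)).
    have := is_deriveB (gz x) (is_derive_line 0 (g (U z t)) x).
    move=> h; apply: (is_derive_congr h) => // y.
    rewrite /v -[y *: g (U z t) in RHS]add0r.
    reflexivity.
  have -> : U z s - U z t - (s - t) *: g (U z t) = v s - v t.
    by rewrite /v scalerBl !opprD !opprK addrACA.
  have inner (a b : R) : `|a| <= tau -> `|b| <= tau -> a <= b ->
      (a = t \/ b = t) -> `|v b - v a| <= L * M * (b - a) ^+ 2.
    move=> at_ bt ab abt.
    have ba : 0 <= b - a by rewrite subr_ge0.
    rewrite expr2 mulrA; apply: (@mvt_norm _ _ _ v (fun x => g (U z x) - g (U z t))) => //.
    - move=> x /andP[ax xb].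
      have xt : `|x| <= tau.
        move: at_ bt; rewrite !ler_norml => /andP[al ar] /andP[bl br].
        by rewrite (le_trans al (ltW ax)) (le_trans (ltW xb)).
      rewrite (le_trans (gL _ _ (Ur _ xt) (Ur _ ttau)))// -mulrA ler_wpM2l//.
      rewrite (le_trans (lipU' _ _ ttau xt))// ler_wpM2l// ler_norml.
      by case: abt => <-; apply/andP; split; lra.
    - by rewrite !mulr_ge0.
  have [st|/ltW st] := leP t s; first by apply: inner => //; left.
  have -> : (s - t) ^+ 2 = (t - s) ^+ 2 by ring.
  by rewrite distrC; apply: inner => //; right.
exists tau, u; split => //.
  rewrite /u; apply: cvg_lim => //.
  apply: (@cvg_trans _ (id z @[z --> F])).
    apply: near_eq_cvg; apply: filterS Fr => z [Dz _].
    by have [->] := DU _ Dz.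
  exact: cvg_within.
move=> t ttau; split; last first.
  apply: (closed_cvg Q Qc _ _ (Uu t (ltW ttau))).
  by apply: filterS Fr => z [Dz _]; exact: DQ.
apply: (@is_derive_of_taylor _ _ _ _ _ (L * M)).
apply/nbhs_ballP; exists (tau - `|t|); first by rewrite /= subr_gt0.
move=> s; rewrite /ball/= => ts; apply: taylor; last exact: ltW.
rewrite -[s](subKr t) (le_trans (ler_normB _ _))//.
by rewrite -lerBrDl ltW.
Qed.

End limits.

(** * The geodesic equation as a first-order system *)

Section Ck_coordinates.
Context {R : realType}.

Lemma derive_mx_coord (V : normedModType R) m n (F : V -> 'M[R]_(m, n)) x v i j :
  differentiable F x -> 'D_v (fun y => F y i j) x = ('D_v F x) i j.
Proof.
move=> dF.
have /is_derive_mxP/(_ i j) H : is_derive x v F ('D_v F x).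
  by apply/derivableP; exact: diff_derivable.
by rewrite derive_val.
Qed.

Lemma Ck_coord (V : normedModType R) m n k (F : V -> 'M[R]_(m, n)) i j :
  Ck k F -> Ck k (fun x => F x i j).
Proof.
elim: k F => [|k IH] F /=.
  move=> cF x; apply: (@continuous_comp _ _ _ F (fun A : 'M[R]_(m, n) => A i j)).
    exact: cF.
  exact: coord_continuous.
move=> [dF cF]; split.
  move=> x; apply: (@differentiable_comp _ _ _ _ F (fun A : 'M[R]_(m, n) => A i j)) => //.
  exact: differentiable_coord.
move=> v.
have -> : (fun x => 'D_v (fun x => F x i j) x) = (fun x => ('D_v F x) i j).
  by apply/funext => x; rewrite derive_mx_coord.
exact: IH.
Qed.

End Ck_coordinates.

Section geodesic_flow.
Context {R : realType} {n : nat} (P : 'rV[R]_n -> 'M[R]_n).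
Hypotheses (P_metric : riemannian_metric P) (P_C2 : Ck 2 P).

(** The acceleration prescribed by the geodesic equation. *)
Definition accel (x v : 'rV[R]_n) : 'rV[R]_n :=
  - \row_k \sum_i \sum_j christoffel P x k i j * v 0 i * v 0 j.

Definition geodesic_field (z : 'rV[R]_(n + n)) : 'rV[R]_(n + n) :=
  row_mx (rsubmx z) (accel (lsubmx z) (rsubmx z)).

Definition state (gamma : R -> 'rV[R]_n) (s : R) : 'rV[R]_(n + n) :=
  row_mx (gamma s) (derive1 gamma s).

(** A row vector in the kernel of P x has zero length. *)
Lemma metric_unitmx x : P x \in unitmx.
Proof.
have [_ Ppos] := P_metric x.
rewrite -row_free_unit -kermx_eq0.
apply/eqP/row_matrixP => i; rewrite row0; apply/eqP; apply: contraT => v0.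
have := Ppos _ v0.
have /sub_kermxP vP : (row i (kermx (P x)) <= kermx (P x))%MS by exact: row_sub.
by rewrite /inner vP mul0mx mxE ltxx.
Qed.

Lemma P_lip i j : lip_on_balls (fun x => P x i j).
Proof.
have [dP cP] := Ck_coord i j P_C2; apply: C1_lip; split=> // v.
have [dPv _] := cP v.
by move=> x; exact: differentiable_continuous.
Qed.

Lemma dP_lip i j v : lip_on_balls (fun x => 'D_v (fun z => P z i j) x).
Proof. by apply: C1_lip; have [_] := Ck_coord i j P_C2; exact. Qed.

Lemma invP_lip : lip_on_balls (fun x => invmx (P x)).
Proof.
by apply: lip_invmx; [exact: metric_unitmx|apply/lip_mxP => i j; exact: P_lip].
Qed.

Lemma christoffel_lip k i j : lip_on_balls (fun x => christoffel P x k i j).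
Proof.
apply: lipM; first exact: lip_cst.
apply: lip_sum => l; apply: lipM.
  by have /lip_mxP := invP_lip; exact.
by apply: lipD; [apply: lipD; exact: dP_lip|apply: lipN; exact: dP_lip].
Qed.

Lemma lip_lsubmx : lip_on_balls (@lsubmx R 1 n n).
Proof.
apply/lip_mxP => i j.
under eq_fun do rewrite mxE; exact: lip_coord.
Qed.

Lemma lip_rsubmx : lip_on_balls (@rsubmx R 1 n n).
Proof.
apply/lip_mxP => i j.
under eq_fun do rewrite mxE; exact: lip_coord.
Qed.

Lemma geodesic_field_lip : lip_on_balls geodesic_field.
Proof.
have accl i j : lip_on_balls
    (fun z : 'rV[R]_(n + n) => accel (lsubmx z) (rsubmx z) i j).
  under eq_fun do rewrite /accel !mxE.
  apply: lipN; apply: lip_sum => a; apply: lip_sum => b.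
  apply: lipM; last exact: ((lip_mxP _).1 lip_rsubmx).
  apply: lipM; last exact: ((lip_mxP _).1 lip_rsubmx).
  exact: (lip_comp (christoffel_lip j a b) lip_lsubmx).
apply/lip_mxP => i k; rewrite /geodesic_field.
rewrite -[k]splitK; case: (fintype.split k) => j.
  by under eq_fun do rewrite row_mxEl; exact: ((lip_mxP _).1 lip_rsubmx).
by under eq_fun do rewrite row_mxEr; exact: accl.
Qed.

Lemma geodesicP I gamma s : geodesic P I gamma -> I s ->
  [/\ is_derive s (1 : R) gamma (derive1 gamma s),
      is_derive s (1 : R) (derive1 gamma) (accel (gamma s) (derive1 gamma s)) &
      inner (P (gamma s)) (derive1 gamma s) (derive1 gamma s) = 1].
Proof.
move=> [_ _ _ geo] Is; have [dg ddg acc unit] := geo s Is.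
split; last exact: unit.
  by rewrite derive1E; exact: derivableP dg.
by rewrite /accel -acc derive1E; exact: derivableP ddg.
Qed.

Lemma is_derive_row_mx (u v : R -> 'rV[R]_n) (s : R) du dv :
  is_derive s (1 : R) u du -> is_derive s (1 : R) v dv ->
  is_derive s (1 : R) (fun t => row_mx (u t) (v t)) (row_mx du dv).
Proof.
move=> /is_derive_mxP du' /is_derive_mxP dv'; apply/is_derive_mxP => i j.
rewrite -[j]splitK; case: (fintype.split j) => k.
  by under [X in is_derive _ _ X _]eq_fun do rewrite row_mxEl; rewrite row_mxEl.
by under [X in is_derive _ _ X _]eq_fun do rewrite row_mxEr; rewrite row_mxEr.
Qed.

Lemma state_solves gamma : geodesic P setT gamma ->
  solves geodesic_field (state gamma).
Proof.
move=> geo t; have [dg ddg _] := geodesicP geo (I : setT t).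
by rewrite /geodesic_field row_mxKl row_mxKr; exact: is_derive_row_mx.
Qed.

Lemma state_continuous gamma : geodesic P setT gamma -> continuous (state gamma).
Proof. by move/state_solves/solves_continuous. Qed.

(** Reading the first-order system back as the second-order equation needs the first
component to have the second as derivative on a neighbourhood, not only at a point. *)
Lemma solves_geodesic (tau : R) u : 0 < tau ->
  (forall t : R, `|t| < tau -> is_derive t (1 : R) u (geodesic_field (u t)) /\
     inner (P (lsubmx (u t))) (rsubmx (u t)) (rsubmx (u t)) = 1) ->
  geodesic P [set t : R | `|t| < tau] (fun t => lsubmx (u t)) /\
  forall t, `|t| < tau -> derive1 (fun t => lsubmx (u t)) t = rsubmx (u t).
Proof.
move=> tau0 usol.
have dl t : `|t| < tau -> is_derive t (1 : R) (fun t => lsubmx (u t)) (rsubmx (u t)).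
  move=> /usol[/is_derive_mxP ut _]; apply/is_derive_mxP => i j.
  under [X in is_derive _ _ X _]eq_fun do rewrite mxE.
  have := ut i (lshift n j).
  by rewrite /geodesic_field row_mxEl.
have dr t : `|t| < tau -> is_derive t (1 : R) (fun t => rsubmx (u t))
    (accel (lsubmx (u t)) (rsubmx (u t))).
  move=> /usol[/is_derive_mxP ut _]; apply/is_derive_mxP => i j.
  under [X in is_derive _ _ X _]eq_fun do rewrite mxE.
  have := ut i (rshift n j).
  by rewrite /geodesic_field row_mxEr.
have d1 t : `|t| < tau -> derive1 (fun t => lsubmx (u t)) t = rsubmx (u t).
  by move=> /dl dlt; rewrite derive1E derive_val.
have opn : open [set t : R | `|t| < tau].
  have -> : [set t : R | `|t| < tau] = ball 0 tau.
    by apply/seteqP; split => x; rewrite /ball/= sub0r normrN.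
  exact: ball_open.
have nd1 t : `|t| < tau ->
    {near t, derive1 (fun t => lsubmx (u t)) =1 (fun t => rsubmx (u t))}.
  move=> tt; have : \forall s \near t, [set t : R | `|t| < tau] s.
    by apply: open_nbhs_nbhs.
  by apply: filterS => s; exact: d1.
split; last exact: d1.
split; first exact: opn.
- move=> x y /= xt yt z /andP[xz zy]; move: xt yt.
  rewrite !ltr_norml => /andP[x1 x2] /andP[y1 y2].
  by rewrite (lt_le_trans x1)//= (le_lt_trans zy).
- by exists 0; rewrite /= normr0.
- move=> t tt; have [_ un] := usol t tt.
  have [dlt _] := dl t tt; have drt := dr t tt.
  have dd : is_derive t (1 : R) (derive1 (fun t => lsubmx (u t)))
      (accel (lsubmx (u t)) (rsubmx (u t))).
    apply: near_eq_is_derive drt.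
    by apply: filterS (nd1 t tt) => s ->.
  have [dd1 dd2] := dd.
  split; [exact: dlt|exact: dd1| |by rewrite (d1 t tt)].
  rewrite derive1E dd2 (d1 t tt); reflexivity.
Qed.

(** The domain I is open, so agreement on I fixes the derivative as well. *)
Lemma eq_geodesic I gamma gamma' s : geodesic P I gamma -> I s ->
  (forall s, I s -> gamma' s = gamma s) -> derive1 gamma' s = derive1 gamma s.
Proof.
move=> [Io _ _ _] Is gg; rewrite !derive1E; apply: near_eq_derive.
have : \forall t \near s, I t by apply: open_nbhs_nbhs.
by apply: filterS => t /gg.
Qed.

(** The definition of totally geodesic sets only looks at geodesics at time 0; shifting
time brings any other point of a geodesic there. *)
Lemma geodesic_shift gamma (c : R) : geodesic P setT gamma ->
  geodesic P setT (fun t => gamma (t + c)) /\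
  derive1 (fun t => gamma (t + c)) = (fun t => derive1 gamma (t + c)).
Proof.
move=> geo.
have sh (t : R) : is_derive t (1 : R) (fun t : R => t + c) 1.
  have := is_deriveD (is_derive_id t (1 : R)) (is_derive_cst c t (1 : R)).
  by move=> h; apply: (is_derive_congr h) => //; rewrite addr0.
have shift_der (u : R -> 'rV[R]_n) (t : R) d : is_derive (t + c) (1 : R) u d ->
    is_derive t (1 : R) (fun t => u (t + c)) d.
  move=> [du <-]; have du' : differentiable u (t + c) by exact/derivable1_diffP.
  exact: (is_derive_comp1 (g := fun t => t + c)).
have d1 : derive1 (fun t => gamma (t + c)) = (fun t => derive1 gamma (t + c)).
  apply/funext => t; rewrite derive1E.
  have [dg _ _] := geodesicP geo (I : setT (t + c)).
  by have dg' := shift_der _ _ _ dg; rewrite derive_val.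
split; last exact: d1.
split; [exact: openT|by move=> x y _ _ z|by exists 0|].
move=> t _; have [dg ddg un] := geodesicP geo (I : setT (t + c)).
have [dgt _] := shift_der _ _ _ dg.
have ddgt := shift_der _ _ _ ddg.
rewrite d1; split; [exact: dgt|by case: ddgt| |exact: un].
by rewrite derive1E; case: ddgt => _ ->.
Qed.

End geodesic_flow.

(** * Compactness of geodesics and level sets of the output *)

Section geodesic_limits.
Context {R : realType} {n : nat} (P : 'rV[R]_n -> 'M[R]_n).
Hypotheses (P_metric : riemannian_metric P) (P_C2 : Ck 2 P).
Hypothesis P_complete : complete_metric P.

Lemma lip_inner (V : normedModType R) (A : V -> 'M[R]_n) (u v : V -> 'rV[R]_n) :
  lip_on_balls A -> lip_on_balls u -> lip_on_balls v ->
  lip_on_balls (fun x => inner (A x) (u x) (v x)).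
Proof.
move=> Al ul vl; apply: (lip_mxP _).1; apply: lip_mulmx; first exact: lip_mulmx.
by apply/lip_mxP => i j; under eq_fun do rewrite mxE; exact: ((lip_mxP _).1 vl).
Qed.

Lemma metric_lip : lip_on_balls P.
Proof. by apply/lip_mxP => i j; exact: P_lip. Qed.

Definition initial_states : set 'rV[R]_(n + n) :=
  [set z | exists gamma, geodesic P setT gamma /\ state gamma 0 = z].

(** A limit of initial states starts a short geodesic, obtained as a limit of geodesics,
and completeness of the metric prolongs it to the whole line. Unit speed
survives because it is a closed condition on states. *)
Lemma initial_states_closed : closed initial_states.
Proof.
move=> z0 z0G.
have /choice[U HU] : forall z, exists gamma : R -> 'rV[R]_n, initial_states z ->
    geodesic P setT gamma /\ state gamma 0 = z.
  move=> z; have [[gamma H]|nz] := pselect (initial_states z).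
    by exists gamma.
  by exists (fun=> 0).
pose speed (z : 'rV[R]_(n + n)) := inner (P (lsubmx z)) (rsubmx z) (rsubmx z).
have speedc : continuous speed.
  apply: (@lip_continuous _ _ R^o); apply: lip_inner; last exact: lip_rsubmx.
    exact: (lip_comp metric_lip lip_lsubmx).
  exact: lip_rsubmx.
have Qc : closed [set z | speed z = 1].
  apply: (@preimage_closed _ R^o speed [set y : R | y = 1]).
    by move=> x _; exact: speedc.
  exact: closed_eq.
have Usol z : initial_states z ->
    state (U z) 0 = z /\ solves (geodesic_field P) (state (U z)).
  by move=> /HU[geo ->]; split => //; exact: state_solves.
have Uspeed z : initial_states z -> forall t, [set z | speed z = 1] (state (U z) t).
  move=> /HU[geo _] t; rewrite /= /speed /state row_mxKl row_mxKr.
  by have [_ _] := geodesicP geo (I : setT t).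
have [tau [u [tau0 u0 usol]]] := limit_solution
  (geodesic_field_lip P_metric P_C2) Usol Qc Uspeed z0G.
have [geo d1] := solves_geodesic tau0 usol.
have [gamma [ggeo geq]] := P_complete geo.
exists gamma; split => //.
have I0 : [set t : R | `|t| < tau] 0 by rewrite /= normr0.
by rewrite /state (eq_geodesic geo I0 geq) geq// d1 ?normr0// hsubmxK.
Qed.

(** The form of continuous dependence that compactness arguments call for: the time s at
which the geodesic is observed varies together with the initial state. The map m
serves to observe it at min r s as well, a time that never exceeds s. *)
Lemma geodesic_dependence gamma (T : R) : geodesic P setT gamma -> 0 <= T ->
  forall (m : R -> R) s0, (forall s, 0 <= s <= T -> 0 <= m s <= T) ->
  {for s0, continuous m} ->
  forall O : set 'rV[R]_(n + n), nbhs (state gamma (m s0)) O ->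
  \forall z \near state gamma 0 & s \near s0, forall gamma',
    geodesic P setT gamma' -> state gamma' 0 = z -> 0 <= s <= T ->
    O (state gamma' (m s)).
Proof.
move=> geo T0 m s0 mT mc O /nbhs_ballP[e /= e0 eO].
have [A [d [A0 d0 dep]]] :=
  continuous_dependence (geodesic_field_lip P_metric P_C2) (state_solves geo) T0.
have e2 : 0 < e / 2 by rewrite divr_gt0.
have e2A : 0 < Num.min d (e / 2 / A) by rewrite lt_min d0 divr_gt0.
have mcs : \forall s \near s0, `|state gamma (m s0) - state gamma (m s)| < e / 2.
  have cm : {for s0, continuous (state gamma \o m)}.
    by apply: continuous_comp => //; exact: (state_continuous geo).
  by move/cvgrPdist_lt : cm; exact.
have zc : \forall z \near state gamma 0, `|z - state gamma 0| < Num.min d (e / 2 / A).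
  apply/nbhs_ballP; exists (Num.min d (e / 2 / A)) => // z.
  by rewrite -ball_normE/= distrC.
exists ([set z | `|z - state gamma 0| < Num.min d (e / 2 / A)],
        [set s | `|state gamma (m s0) - state gamma (m s)| < e / 2]) => //.
move=> [z s] /= [zd sd] gamma' geo' z' sT.
move: zd; rewrite lt_min => /andP[zd ze].
apply: eO; rewrite -ball_normE/=.
rewrite -[state gamma _ - _](subrKA (state gamma (m s))).
apply: (le_lt_trans (ler_normD _ _)); rewrite (splitr e).
apply: ltrD; first exact: sd.
rewrite distrC; rewrite -z' in zd ze.
apply: (le_lt_trans (dep _ (state_solves geo') zd _ (mT _ sT))).
by rewrite mulrC -ltr_pdivlMr.
Qed.

End geodesic_limits.

Section level_sets.
Context {R : realType} {n : nat} (P : 'rV[R]_n -> 'M[R]_n).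
Hypotheses (P_metric : riemannian_metric P) (P_C2 : Ck 2 P).
Hypothesis P_complete : complete_metric P.
Context (h : 'rV[R]_n -> 'rV[R]_1) (h_C1 : Ck 1 h).

Definition output_rate (z : 'rV[R]_(n + n)) : R :=
  'D_(rsubmx z) (fun x => h x 0 0) (lsubmx z).

Lemma output_differentiable x : differentiable (fun x => h x 0 0) x.
Proof. by have [] := Ck_coord 0 0 h_C1. Qed.

Lemma output_rateE x v : output_rate (row_mx x v) = (v *m jacobian h x) 0 0.
Proof.
have [dh _] := h_C1.
by rewrite /output_rate row_mxKl row_mxKr derive_mx_coord// deriveEjacobian.
Qed.

Lemma output_rate_continuous : continuous output_rate.
Proof.
have [_ cD] := Ck_coord 0 0 h_C1.
have -> : output_rate = fun z => \sum_i rsubmx z 0 i *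
    'D_(delta_mx 0 i) (fun x => h x 0 0) (lsubmx z).
  by apply/funext => z; rewrite /output_rate derive_coord//; exact: output_differentiable.
move=> z; apply: cvg_sumr => [|i]; first exact: nbhs_filter.
have c1 : {for z, continuous (fun z : 'rV[R]_(n + n) => rsubmx z 0 i)}.
  apply: (@continuous_comp _ _ _ (@rsubmx R 1 n n) (fun x : 'rV[R]_n => x 0 i)).
    exact: lip_continuous lip_rsubmx _.
  exact: coord_continuous.
have c2 : {for z, continuous (fun z : 'rV[R]_(n + n) =>
    'D_(delta_mx 0 i) (fun x => h x 0 0) (lsubmx z))}.
  apply: (@continuous_comp _ _ _ (@lsubmx R 1 n n)
    (fun x : 'rV[R]_n => 'D_(delta_mx 0 i) (fun x => h x 0 0) x)).
    exact: lip_continuous lip_lsubmx _.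
  exact: cD.
exact: (cvgM c1 c2).
Qed.

Lemma is_derive_output gamma (s : R) : geodesic P setT gamma ->
  is_derive s (1 : R) (fun t => h (gamma t) 0 0) (output_rate (state gamma s)).
Proof.
move=> geo; have [dg _ _] := geodesicP geo (I : setT s).
rewrite /output_rate /state row_mxKl row_mxKr.
exact: (is_derive_comp1 (F := fun x => h x 0 0) (output_differentiable _) dg).
Qed.

Context (C : set 'rV[R]_n).
Hypothesis level_tg : forall y, (h @` C) y ->
  totally_geodesic P (fun x => h x - y) C.

(** The totally geodesic hypothesis is about the Jacobian of h - y. *)
Lemma jacobian_sub_cst (y : 'rV[R]_1) x : differentiable h x ->
  jacobian (fun x => h x - y) x = jacobian h x.
Proof.
move=> dh; apply: jacobian_eq; first by apply: differentiableB.
move=> v.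
have dhd : derivable h x v by exact: diff_derivable.
have dE := deriveB dhd (@derivable_cst _ _ _ y x v).
rewrite derive_cst subr0 in dE.
exact: (etrans dE (deriveEjacobian v dh)).
Qed.

(** If the velocity is tangent to the level set of h at one point, the totally geodesic
hypothesis traps the whole geodesic segment in that level set. *)
Lemma level_constant gamma (a b c r : R) : geodesic P setT gamma ->
  (forall t, a <= t <= b -> C (gamma t)) -> a <= c <= b ->
  output_rate (state gamma c) = 0 -> a <= r <= b -> h (gamma r) = h (gamma c).
Proof.
move=> geo stay cab rate0 rab.
have [dh _] := h_C1.
have Cc : C (gamma c) by exact: stay.
have [geo' d1] := geodesic_shift c geo.
have hy : (h @` C) (h (gamma c)) by exists (gamma c).
have [_ _ un] := geodesicP geo (I : setT c).
apply/eqP; rewrite -subr_eq0; apply/eqP.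
have d1c : derive1 (fun t => gamma (t + c)) 0 = derive1 gamma c.
  by rewrite d1 add0r.
have tg v0 := level_tg hy (subrr _) Cc v0 un geo' I (congr1 gamma (add0r c)) d1c.
have rate0' : derive1 gamma c *m
    jacobian (fun x => h x - h (gamma c)) (gamma c) = 0.
  rewrite jacobian_sub_cst; last exact: dh.
  by apply/rowP => j; rewrite ord1 -output_rateE [RHS]mxE.
have sJ : stay_interval C setT (fun t => gamma (t + c)) (r - c).
  exists `[a - c, b - c]%classic; last by rewrite /= in_itv/= !lerD2r.
  split.
  - exact: interval_is_interval.
  - by rewrite /= in_itv/= subr_le0 subr_ge0.
  - by [].
  - move=> _ [t /= + <-]; rewrite in_itv/= lerBlDr lerBrDr => tab.
    exact: stay.
have := tg rate0' _ sJ.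
by rewrite subrK.
Qed.

(** Hence along a geodesic segment in C the rate of change of the output either vanishes
identically or has no zero. At the ends of the segment this comes from the
continuity of the rate. *)
Lemma output_rate_zero gamma (a b c r : R) : geodesic P setT gamma ->
  (forall t, a <= t <= b -> C (gamma t)) -> a <= c <= b ->
  output_rate (state gamma c) = 0 -> a <= r <= b ->
  output_rate (state gamma r) = 0.
Proof.
move=> geo stay cab rate0 rab.
have hcst t : a <= t <= b -> h (gamma t) 0 0 = h (gamma c) 0 0.
  by move=> tab; rewrite (level_constant geo stay cab rate0 tab).
apply: contrapT => /eqP rate_r.
have ac : continuous (fun t => `|output_rate (state gamma t)|).
  move=> t; apply: (@continuous_comp _ _ _
    (fun t => output_rate (state gamma t)) (fun y : R => `|y|)).
    apply: (@continuous_comp _ _ _ (state gamma) output_rate).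
      exact: (state_continuous geo).
    exact: output_rate_continuous.
  exact: (@norm_continuous _ R^o).
have near_r : \forall t \near r, 0 < `|output_rate (state gamma t)|.
  by apply: (cvgr_gt _ (ac r)); rewrite normr_gt0.
have /nbhs_ballP[e /= e0 re] := near_r.
(* On a subinterval where the rate does not vanish, the mean value theorem
   contradicts the constancy of the output. *)
have no (x y : R) : a <= x -> x < y -> y <= b ->
    (forall t, x < t < y -> `|r - t| < e) -> False.
  move=> ax xy yb xye.
  have cH : {within `[x, y], continuous (fun t => h (gamma t) 0 0)}.
    apply: derivable_within_continuous => t _.
    by have [] := is_derive_output t geo.
  have [t] := MVT xy (fun t _ => is_derive_output t geo) cH.
  rewrite in_itv/= => txy.
  rewrite !hcst ?ax ?yb ?(ltW xy) ?(le_trans ax) ?(ltW xy) ?(le_trans (ltW xy))//.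
  rewrite subrr => /esym/eqP; rewrite mulf_eq0 subr_eq0 [y == x]gt_eqF// orbF.
  move=> /eqP rt0; have := re t; rewrite /ball/= rt0 normr0 ltxx.
  by move=> /(_ (xye t txy)).
have [rb|rb] := ltP r b.
  apply: (no r (Num.min b (r + e))).
  - by case/andP: rab.
  - by rewrite lt_min rb ltrDl.
  - by rewrite ge_min lexx.
  - move=> t /andP[rt]; rewrite lt_min => /andP[_ te].
    by rewrite distrC gtr0_norm ?subr_gt0// ltrBlDl.
have [ar|ra] := ltP a r.
  apply: (no (Num.max a (r - e)) r).
  - by rewrite le_max lexx.
  - by rewrite gt_max ar ltrBlDr ltrDl.
  - by case/andP: rab.
  - move=> t /andP[]; rewrite gt_max => /andP[_ te] tr.
    by rewrite gtr0_norm ?subr_gt0// ltrBlDr -ltrBlDl.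
have rE : r = c.
  apply/eqP; rewrite eq_le.
  by case/andP: cab => ac' cb; rewrite (le_trans ra ac') (le_trans cb rb).
by move: rate_r; rewrite rE rate0 eqxx.
Qed.

End level_sets.

(** * The uniform gain *)

Section gain.
Context {R : realType} {n : nat} (P : 'rV[R]_n -> 'M[R]_n).
Hypotheses (P_metric : riemannian_metric P) (P_C2 : Ck 2 P).
Hypothesis P_complete : complete_metric P.
Context (h : 'rV[R]_n -> 'rV[R]_1) (h_C1 : Ck 1 h).
Context (C : set 'rV[R]_n) (C_closed : closed C).
Hypothesis level_tg : forall y, (h @` C) y ->
  totally_geodesic P (fun x => h x - y) C.
Context (rho : 'rV[R]_n -> R) (rho_C1 : Ck 1 rho).
Hypothesis rho_ge0 : forall x, 0 <= rho x.

(** Along a unit-speed geodesic in C, half the Lie derivative of the metric may exceed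
-q/2 by this term; the observer gain has to absorb it. *)
Definition excess (z : 'rV[R]_(n + n)) : R :=
  2^-1 * rho (lsubmx z) * output_rate h z ^+ 2.

Lemma excess_continuous : continuous excess.
Proof.
move=> z; have ac := output_rate_continuous h_C1 (x := z).
have rc : {for z, continuous (fun z : 'rV[R]_(n + n) => rho (lsubmx z))}.
  apply: (@continuous_comp _ _ _ (@lsubmx R 1 n n) rho).
    exact: lip_continuous lip_lsubmx _.
  have [drho _] := rho_C1.
  exact: differentiable_continuous.
exact: (cvgM (cvgM (cvg_cst (2^-1 : R)) rc) (cvgM ac ac)).
Qed.

Definition stays_in gamma (s : R) := forall r, 0 <= r <= s -> C (gamma r).

Lemma half_lt (x : R) : 0 < x -> x / 2 < x.
Proof. by move=> x0; rewrite ltr_pdivrMr// ltr_pMr// ltr1n. Qed.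

Lemma half_gt0 (x : R) : 0 < x -> 0 < x / 2.
Proof. by move=> x0; rewrite divr_gt0. Qed.

(** The heart of the proof. Let gamma0 be the geodesic of initial state z0. If it has left
C by time s0, so have its neighbours, and there is nothing to prove. If its output
rate vanishes at s0, the excess is below q nearby. Otherwise the rate vanishes
neither at s0 nor, by output_rate_zero, at 0; it is then bounded away
from 0 at both times for all neighbours, and a large gain kappa wins.
States that are not limits of initial states of geodesics impose no condition. *)
Lemma gain_near (q E : R) (z0 : 'rV[R]_(n + n)) (s0 : R) : 0 < q -> 0 <= E -> 0 <= s0 <= E ->
  \forall x \near ((z0, s0) : ('rV[R]_(n + n) * R)%type) & kappa \near +oo%R,
    forall gamma, geodesic P setT gamma -> state gamma 0 = x.1 ->
    0 <= x.2 <= E -> stays_in gamma x.2 ->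
    excess (state gamma x.2) <= q +
      kappa * (`|output_rate h (state gamma x.2)| * `|output_rate h (state gamma 0)|).
Proof.
move=> q0 E0 s0E.
have [z0G|z0G] := pselect (initial_states P z0); last first.
  have nG : \forall z \near z0, ~ initial_states P z.
    apply: open_nbhs_nbhs; split => //; apply: closed_openC.
    exact: initial_states_closed.
  near=> x kappa => gamma geo st0; exfalso.
  suff : ~ initial_states P x.1 by apply; exists gamma.
  near: x; exists ([set z | ~ initial_states P z], setT).
    by split => //; exact: filterT.
  by move=> [z s] [].
have [gamma0 [geo0 st00]] := z0G.
have idE s : 0 <= s <= E -> 0 <= s <= E by [].
have [stay|] := pselect (stays_in gamma0 s0); last first.
  move=> /existsNP[r /not_implyP[/andP[r0 rs0] nC]].
  have mE s : 0 <= s <= E -> 0 <= Num.min r s <= E.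
    by move=> /andP[s0' sE]; rewrite le_min r0 s0' ge_min sE orbT.
  have mc : {for s0, continuous (fun s : R => Num.min r s)}.
    apply: continuous_min; first exact: cst_continuous.
    exact: cvg_id.
  have Cc : nbhs (state gamma0 (Num.min r s0)) [set z | ~ C (lsubmx z)].
    have lc := lip_continuous (@lip_lsubmx R n) (x := state gamma0 (Num.min r s0)).
    have nC' : nbhs (lsubmx (state gamma0 (Num.min r s0))) (~` C).
      apply: open_nbhs_nbhs; split; first exact: closed_openC.
      by rewrite /setC /= row_mxKl (min_idPl rs0).
    exact: (lc _ nC').
  have := geodesic_dependence P_metric P_C2 geo0 E0 mE mc Cc.
  rewrite st00 => near0.
  near=> x kappa => gamma geo st0 xE sti; exfalso.
  suff : ~ C (lsubmx (state gamma (Num.min r x.2))).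
    rewrite row_mxKl; apply; apply: sti.
    by have /andP[x0 _] := xE; rewrite le_min r0 x0 ge_min lexx orbT.
  have : forall gamma', geodesic P setT gamma' -> state gamma' 0 = x.1 ->
    0 <= x.2 <= E -> ~ C (lsubmx (state gamma' (Num.min r x.2))).
    by near: x; case: near0 => -[A B] [/= nA nB] AB; exists (A, B) => //
      -[z s] /= [Az Bs]; exact: (AB (z, s)).
  by move=> /(_ gamma geo st0 xE).
have idc : {for s0, continuous (fun s : R => s)} by exact: cvg_id.
pose alpha := `|output_rate h (state gamma0 s0)|.
pose beta := `|output_rate h (state gamma0 0)|.
have rc : continuous (fun z => `|output_rate h z|).
  by move=> z; apply: continuous_comp; [exact: output_rate_continuous|exact: norm_continuous].
have [a0|a0] := eqVneq (output_rate h (state gamma0 s0)) 0.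
  have exq : nbhs (state gamma0 s0) [set z | excess z < q].
    apply: (cvgr_lt _ (excess_continuous (x := state gamma0 s0))).
    by rewrite /excess a0 expr0n mulr0.
  have := geodesic_dependence P_metric P_C2 geo0 E0 idE idc exq.
  rewrite st00 => near0.
  near=> x kappa => gamma geo st0 xE sti.
  rewrite (le_trans (y := q))//; last first.
    have k0 : 0 <= kappa by near: kappa; exact: nbhs_pinfty_ge.
    by rewrite lerDl mulr_ge0// mulr_ge0.
  apply: ltW.
  have : forall gamma', geodesic P setT gamma' -> state gamma' 0 = x.1 ->
    0 <= x.2 <= E -> excess (state gamma' x.2) < q.
    by near: x; case: near0 => -[A B] [/= nA nB] AB; exists (A, B) => //
      -[z s] /= [Az Bs]; exact: (AB (z, s)).
  by move=> /(_ gamma geo st0 xE).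
have b0 : output_rate h (state gamma0 0) != 0.
  apply: contra_neq a0 => b0.
  have s00 : 0 <= s0 by case/andP: s0E.
  by apply: (output_rate_zero h_C1 level_tg geo0 stay _ b0); rewrite ?lexx ?s00.
have alpha0 : 0 < alpha by rewrite /alpha normr_gt0; exact: a0.
have beta0 : 0 < beta by rewrite /beta normr_gt0; exact: b0.
have nb : \forall z \near z0, beta / 2 < `|output_rate h z|.
  rewrite -st00; apply: (cvgr_gt _ (rc (state gamma0 0))); exact: half_lt beta0.
have nb' : nbhs ((z0, s0) : ('rV[R]_(n + n) * R)%type)
    [set x | beta / 2 < `|output_rate h x.1|].
  exists ([set z | beta / 2 < `|output_rate h z|], setT).
    by split => //; exact: filterT.
  by move=> [z s] [].
pose M := excess (state gamma0 s0) + 1.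
have exM : nbhs (state gamma0 s0)
    [set z | excess z < M /\ alpha / 2 < `|output_rate h z|].
  apply: filterI.
    apply: (cvgr_lt _ (excess_continuous (x := state gamma0 s0))).
    by rewrite /M ltrDl.
  apply: (cvgr_gt _ (rc (state gamma0 s0))); exact: half_lt alpha0.
have := geodesic_dependence P_metric P_C2 geo0 E0 idE idc exM.
rewrite st00 => near0.
have M0 : 0 <= M by apply: addr_ge0 => //; apply: mulr_ge0; [exact: mulr_ge0|exact: sqr_ge0].
near=> x kappa => gamma geo st0 xE sti.
have [exx ax] : excess (state gamma x.2) < M /\
    alpha / 2 < `|output_rate h (state gamma x.2)|.
  have : forall gamma', geodesic P setT gamma' -> state gamma' 0 = x.1 ->
    0 <= x.2 <= E -> excess (state gamma' x.2) < M /\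
    alpha / 2 < `|output_rate h (state gamma' x.2)|.
    by near: x; case: near0 => -[A B] [/= nA nB] AB; exists (A, B) => //
      -[z s] /= [Az Bs]; exact: (AB (z, s)).
  by move=> /(_ gamma geo st0 xE).
have bx : beta / 2 < `|output_rate h (state gamma 0)|.
  by rewrite st0 /=; near: x; exact: nb'.
have kM : M / (alpha / 2 * (beta / 2)) <= kappa.
  near: kappa; apply: nbhs_pinfty_ge; exact: num_real.
have a2 := half_gt0 alpha0; have b2 := half_gt0 beta0.
have ab0 := mulr_gt0 a2 b2.
have k0 : 0 <= kappa.
  by apply: (le_trans _ kM); apply: divr_ge0; [exact: M0|exact: ltW].
apply: (le_trans (ltW exx)).
apply: (@le_trans _ _ (kappa * (alpha / 2 * (beta / 2)))).
  by rewrite -(ler_pdivrMr _ _ ab0); exact: kM.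
apply: (@le_trans _ _ (kappa * (`|output_rate h (state gamma x.2)| *
    `|output_rate h (state gamma 0)|))).
  apply: ler_wpM2l; first exact: k0.
  exact: (ler_pM (ltW a2) (ltW b2) (ltW ax) (ltW bx)).
by rewrite lerDr; exact: ltW q0.
Unshelve. all: by end_near. Qed.

(** The quadratic form P has a positive minimum on a compact set of points and unit
vectors, for the norm of the coordinates. *)
Lemma unit_bounded (N : R) : exists2 B, 0 <= B & forall x v, `|x| <= N ->
  inner (P x) v v = 1 -> `|v| <= B.
Proof.
(* Pairs (base point, unit vector) are encoded as states; the bound on |z| makes the
   set visibly compact. *)
pose K := [set z : 'rV[R]_(n + n) | `|z| <= `|N| + 1 /\
  (`|lsubmx z| <= N /\ `|rsubmx z| = 1)].
have Kc : compact K.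
  apply: (subclosed_compact _ (@closed_ball_compact R (n + n) (`|N| + 1))); last first.
    by move=> z [].
  apply: closedI.
    apply: (@preimage_closed _ _ (fun x : 'rV[R]_(n + n) => `|x|) [set y : R | y <= `|N| + 1]).
      by move=> x _; exact: norm_continuous.
    exact: closed_le.
  have ncl : continuous (fun z : 'rV[R]_(n + n) => `|lsubmx z|).
    move=> z; apply: continuous_comp; last exact: norm_continuous.
    exact: (lip_continuous lip_lsubmx).
  have ncr : continuous (fun z : 'rV[R]_(n + n) => `|rsubmx z|).
    move=> z; apply: continuous_comp; last exact: norm_continuous.
    exact: (lip_continuous lip_rsubmx).
  apply: closedI.
    apply: (@preimage_closed _ _ (fun x : 'rV[R]_(n + n) => `|lsubmx x|) [set y : R | y <= N]).
      by move=> x _; exact: ncl.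
    exact: closed_le.
  apply: (@preimage_closed _ _ (fun x : 'rV[R]_(n + n) => `|rsubmx x|) [set y : R | y = 1]).
    by move=> x _; exact: ncr.
  exact: closed_eq.
pose S (z : 'rV[R]_(n + n)) := inner (P (lsubmx z)) (rsubmx z) (rsubmx z).
have Sc : continuous S.
  apply: (@lip_continuous _ _ R^o); apply: lip_inner; last exact: lip_rsubmx.
    exact: (lip_comp (metric_lip P_C2) lip_lsubmx).
  exact: lip_rsubmx.
have inK x v : `|x| <= N -> v != 0 -> K (row_mx x (`|v|^-1 *: v)).
  move=> xN v0.
  have v1 : `|(`|v|^-1 *: v)| = 1.
    by rewrite normrZ normfV normr_id mulVf// normr_eq0.
  split; last by rewrite row_mxKl row_mxKr.
  apply: mx_norm_le => [|i j]; first by rewrite addr_ge0.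
  rewrite -[j]splitK; case: (fintype.split j) => k /=.
    rewrite row_mxEl (le_trans (ler_coord_norm _ _ _))// (le_trans xN)//.
    by rewrite (le_trans (ler_norm N))// lerDl.
  by rewrite row_mxEr (le_trans (ler_coord_norm _ _ _))// v1 lerDr.
have v_neq0 x v : inner (P x) v v = 1 -> v != 0.
  move=> v1; apply/eqP => v0; move: v1; rewrite v0 /inner !mul0mx mxE.
  by move/eqP; rewrite eq_sym oner_eq0.
have [K0|/set0P/negP/negPn/eqP K0] := pselect (K !=set0); last first.
  exists 0 => // x v xN v1; have := inK x v xN (v_neq0 _ _ v1).
  by rewrite K0.
have [z0 + minS] := EVT_min_rV K0 Kc (continuous_subspaceT Sc).
rewrite inE => Kz0.
have S0 : 0 < S z0.
  have [_ Ppos] := P_metric (lsubmx z0); apply: Ppos.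
  case: Kz0 => _ [_ r1]; rewrite -normr_eq0 r1; exact: oner_neq0.
exists ((S z0)^-1 + 1); first by rewrite addr_ge0// invr_ge0 ltW.
move=> x v xN v1; have v0 := v_neq0 _ _ v1.
have nv0 : 0 < `|v| by rewrite normr_gt0.
have := minS _ (mem_set (inK x v xN v0)).
have -> : S (row_mx x (`|v|^-1 *: v)) = (`|v| ^+ 2)^-1.
  rewrite /S row_mxKl row_mxKr /inner -!scalemxAl linearZ /= -scalemxAr.
  rewrite mxE mxE; move: v1; rewrite /inner => ->.
  by rewrite mulr1 -invfM expr2.
rewrite -[X in X <= _]invrK lef_pV2 ?posrE ?exprn_gt0 ?invr_gt0// => v2.
have [v1'|v1'] := leP `|v| 1.
  by rewrite (le_trans v1')// lerDr invr_ge0 ltW.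
rewrite (@le_trans _ _ (`|v| ^+ 2))//.
  by rewrite expr2 ler_peMl// ltW.
by rewrite (le_trans v2)// lerDl.
Qed.

(** The pairs (initial state, time) with base point in a ball and time in [0, E] lie
in a compact set, so the local gains of gain_near combine into a uniform one. *)
Lemma gain_exists (N q E : R) : 0 < q -> 0 <= E ->
  exists kappa, forall kappa', kappa <= kappa' ->
  forall gamma s, geodesic P setT gamma ->
    `|gamma 0| <= N -> 0 <= s <= E -> stays_in gamma s ->
    excess (state gamma s) <= q +
      kappa' * (`|output_rate h (state gamma s)| * `|output_rate h (state gamma 0)|).
Proof.
move=> q0 E0; have [B B0 unitB] := unit_bounded N.
pose K := [set z : 'rV[R]_(n + n) | `|z| <= `|N| + B] `*` [set s : R | s \in `[0, E]].
have Kc : compact K.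
  by apply: compact_setX; [exact: closed_ball_compact|exact: segment_compact].
have := (compact_near_coveringP K).1 Kc R (pinfty_nbhs R) (fun kappa x =>
  forall gamma, geodesic P setT gamma -> state gamma 0 = x.1 ->
    0 <= x.2 <= E -> stays_in gamma x.2 ->
    excess (state gamma x.2) <= q +
      kappa * (`|output_rate h (state gamma x.2)| * `|output_rate h (state gamma 0)|)) _.
case.
  move=> [z s] [_ /=]; rewrite in_itv/= => sE.
  exact: gain_near.
move=> k0 [k0r k0P].
exists (`|k0| + 1).
move=> k kk gamma s geo gN sE sti.
apply: (k0P k _ (state gamma 0, s)) => //.
  by rewrite (lt_le_trans _ kk)// (le_lt_trans (ler_norm _))// ltrDl.
split => /=; last by rewrite in_itv.
have [_ _ un] := geodesicP geo (I : setT 0).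
have vB := unitB _ _ gN un.
apply: mx_norm_le => [|i j]; first by rewrite addr_ge0.
rewrite -[j]splitK; case: (fintype.split j) => l.
  rewrite row_mxEl (le_trans (ler_coord_norm _ _ _))// (le_trans gN)//.
  by rewrite (le_trans (ler_norm N))// lerDl.
by rewrite row_mxEr (le_trans (ler_coord_norm _ _ _))// (le_trans vB)// lerDr.
Qed.

End gain.

(** * The first variation formula *)

Section inner_product.
Context {R : realType} {n : nat}.
Implicit Types (A B : 'M[R]_n) (u v w : 'rV[R]_n).

Lemma innerE A u v : inner A u v = \sum_i \sum_j u 0 i * A i j * v 0 j.
Proof.
rewrite /inner mxE exchange_big; apply: eq_bigr => j _.
by rewrite !mxE mulr_suml; apply: eq_bigr.
Qed.

Lemma innerBm A B u v : inner (A - B) u v = inner A u v - inner B u v.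
Proof. by rewrite /inner mulmxBr mulmxBl !mxE. Qed.

Lemma innerDl A u v w : inner A (u + v) w = inner A u w + inner A v w.
Proof. by rewrite /inner !mulmxDl mxE. Qed.

Lemma innerDr A u v w : inner A u (v + w) = inner A u v + inner A u w.
Proof. by rewrite /inner linearD mulmxDr mxE. Qed.

Lemma innerBr A u v w : inner A u (v - w) = inner A u v - inner A u w.
Proof. by rewrite /inner linearB mulmxBr !mxE. Qed.

Lemma innerZr A u a v : inner A u (a *: v) = a * inner A u v.
Proof. by rewrite /inner linearZ /= -scalemxAr mxE. Qed.

Lemma inner_tr A u v : inner A^T u v = inner A v u.
Proof.
rewrite !innerE exchange_big; apply: eq_bigr => i _; apply: eq_bigr => j _.
by rewrite mxE; ring.
Qed.

Lemma inner_norm_le A u v : `|inner A u v| <= n%:R ^+ 2 * (`|A| * `|u| * `|v|).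
Proof.
rewrite innerE (le_trans (ler_norm_sum _ _ _))//.
apply: (@le_trans _ _ (\sum_(i < n) n%:R * (`|A| * `|u| * `|v|))).
  apply: ler_sum => i _; rewrite (le_trans (ler_norm_sum _ _ _))//.
  apply: (@le_trans _ _ (\sum_(j < n) `|A| * `|u| * `|v|)).
    apply: ler_sum => j _; rewrite !normrM [`|A| * _]mulrC.
    by rewrite ler_pM ?mulr_ge0 ?ler_pM ?ler_coord_norm.
  by rewrite sumr_const card_ord [leRHS]mulr_natl.
by rewrite sumr_const card_ord -[leLHS]mulr_natl mulrA expr2.
Qed.

Lemma inner_le_bound A u v (a b c : R) :
  `|A| <= a -> `|u| <= b -> `|v| <= c -> inner A u v <= n%:R ^+ 2 * (a * b * c).
Proof.
move=> Aa ub vc; have := le_trans (ler_norm _) (inner_norm_le A u v).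
move=> /le_trans; apply; rewrite ler_wpM2l ?exprn_ge0//.
by rewrite ler_pM ?mulr_ge0 ?ler_pM.
Qed.

Lemma cvg_inner (T : Type) (F : set_system T) (A : T -> 'M[R]_n)
    (u v : T -> 'rV[R]_n) A0 u0 v0 : Filter F ->
  A @ F --> A0 -> u @ F --> u0 -> v @ F --> v0 ->
  inner (A t) (u t) (v t) @[t --> F] --> inner A0 u0 v0.
Proof.
move=> FF cA cu cv; rewrite innerE; under eq_fun do rewrite innerE.
apply: cvg_sumr => i; apply: cvg_sumr => j.
have cAij := cvg_comp A (fun B : 'M[R]_n => B i j) cA (@coord_continuous _ _ _ i j A0).
have cui := cvg_comp u (fun w : 'rV[R]_n => w 0 i) cu (@coord_continuous _ _ _ 0 i u0).
have cvj := cvg_comp v (fun w : 'rV[R]_n => w 0 j) cv (@coord_continuous _ _ _ 0 j v0).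
exact: (cvgM (cvgM cui cAij) cvj).
Qed.

Lemma is_derive_inner (W : normedModType R) (A : W -> 'M[R]_n)
    (u v : W -> 'rV[R]_n) (s d : W) dA du dv :
  is_derive s d A dA -> is_derive s d u du -> is_derive s d v dv ->
  is_derive s d (fun t => inner (A t) (u t) (v t))
    (inner dA (u s) (v s) + inner (A s) du (v s) + inner (A s) (u s) dv).
Proof.
move=> /is_derive_mxP dA' /is_derive_mxP du' /is_derive_mxP dv'.
have -> : (fun t => inner (A t) (u t) (v t)) =
    \sum_i \sum_j (fun t => u t 0 i * A t i j * v t 0 j).
  apply/funext => t; rewrite innerE fct_sumE; apply: eq_bigr => i _.
  by rewrite fct_sumE.
have -> : inner dA (u s) (v s) + inner (A s) du (v s) + inner (A s) (u s) dv =
    \sum_i \sum_j (u s 0 i * dA i j * v s 0 j + du 0 i * A s i j * v s 0 j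
      + u s 0 i * A s i j * dv 0 j).
  rewrite !innerE -!big_split/=; apply: eq_bigr => i _.
  by rewrite -!big_split/=.
apply: is_derive_sum => i; apply: is_derive_sum => j.
have H := is_deriveM (is_deriveM (du' 0 i) (dA' i j)) (dv' 0 j).
apply: (is_derive_congr H) => //.
rewrite /GRing.scale/= [X in X * dv 0 j](_ : _ = u s 0 i * A s i j)//; ring.
Qed.

End inner_product.

Section first_variation.
Context {R : realType} {n : nat} (P : 'rV[R]_n -> 'M[R]_n).
Hypotheses (P_metric : riemannian_metric P) (P_C2 : Ck 2 P).

Lemma metric_sym x : (P x)^T = P x.
Proof. by have [] := P_metric x. Qed.

Lemma metric_differentiable x : differentiable P x.
Proof. by have [] := P_C2. Qed.

Lemma inner_sym x u v : inner (P x) u v = inner (P x) v u.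
Proof. by rewrite -[in LHS]metric_sym inner_tr. Qed.

Lemma dmetric_sym x w : ('D_w P x)^T = 'D_w P x.
Proof.
apply/matrixP => i j; rewrite mxE -!derive_mx_coord; [|exact: metric_differentiable..].
congr ('D_w _ x); apply/funext => y.
by have /matrixP/(_ i j) := metric_sym y; rewrite mxE.
Qed.

Lemma inner_derive_sum x w u v :
  inner ('D_w P x) u v = \sum_l w 0 l * inner ('D_(delta_mx 0 l) P x) u v.
Proof.
rewrite (derive_coord w (metric_differentiable x)).
under [RHS]eq_bigr do rewrite innerE mulr_sumr.
rewrite innerE [RHS]exchange_big; apply: eq_bigr => i _.
under [RHS]eq_bigr do rewrite mulr_sumr.
rewrite [RHS]exchange_big; apply: eq_bigr => j _.
rewrite summxE mulr_sumr mulr_suml; apply: eq_bigr => l _.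
rewrite mxE; ring.
Qed.

(** Multiplying by P cancels the inverse metric in the Christoffel symbols; by symmetry
of P the first two of its three terms coincide after contraction with v. *)
Lemma inner_accel x v w :
  inner (P x) (accel P x v) w =
  2^-1 * inner ('D_w P x) v v - inner ('D_v P x) v w.
Proof.
have dP := metric_differentiable x.
pose B l := 'D_(delta_mx 0 l) P x.
pose b : 'rV[R]_n := \row_l (\sum_i \sum_j
  (2^-1 * (B i l j + B j l i - B l i j)) * v 0 i * v 0 j).
have accE : accel P x v = - (b *m invmx (P x)).
  rewrite /accel; congr (- _); apply/rowP => k; rewrite !mxE.
  under [RHS]eq_bigr do rewrite mxE mulr_suml.
  rewrite [RHS]exchange_big; apply: eq_bigr => i _.
  under [RHS]eq_bigr do rewrite mulr_suml.
  rewrite [RHS]exchange_big; apply: eq_bigr => j _.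
  rewrite /christoffel mulr_sumr !mulr_suml; apply: eq_bigr => l _.
  rewrite /partial !derive_mx_coord// -/(B _) -/(B _) -/(B _).
  have -> : invmx (P x) k l = invmx (P x) l k.
    by rewrite -[in LHS]metric_sym -trmx_inv mxE.
  ring.
have -> : inner (P x) (accel P x v) w = - \sum_l b 0 l * w 0 l.
  rewrite /inner accE mulNmx -mulmxA mulVmx; last exact: metric_unitmx.
  rewrite mulmx1 mulNmx mxE; congr (- _).
  by rewrite [LHS]mxE; apply: eq_bigr => l _; rewrite [w^T _ _]mxE.
have bE l : b 0 l = inner ('D_v P x) (delta_mx 0 l) v - 2^-1 * inner (B l) v v.
  rewrite mxE inner_derive_sum.
  have innerd (M : 'M[R]_n) : inner M (delta_mx 0 l) v = \sum_j M l j * v 0 j.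
    by rewrite /inner -rowE mxE; apply: eq_bigr => j _; rewrite !mxE.
  under [in RHS]eq_bigr do rewrite innerd mulr_sumr.
  rewrite innerE mulr_sumr.
  have -> : \sum_i \sum_j 2^-1 * (B i l j + B j l i - B l i j) * v 0 i * v 0 j =
     2^-1 * (\sum_i \sum_j B i l j * v 0 i * v 0 j) +
     2^-1 * (\sum_i \sum_j B j l i * v 0 i * v 0 j) -
     2^-1 * (\sum_i \sum_j v 0 i * B l i j * v 0 j).
    rewrite -mulrDr -mulrBr -big_split -sumrB mulr_sumr; apply: eq_bigr => i _.
    rewrite -big_split -sumrB mulr_sumr; apply: eq_bigr => j _ /=; ring.
  have -> : \sum_i \sum_j B j l i * v 0 i * v 0 j = \sum_i \sum_j B i l j * v 0 i * v 0 j.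
    rewrite exchange_big; apply: eq_bigr => i _; apply: eq_bigr => j _; ring.
  have half2 : 2^-1 + 2^-1 = 1 :> R by field.
  rewrite -mulrDl half2 mul1r.
  rewrite -mulr_sumr; congr (_ - _).
  by apply: eq_bigr => i _; apply: eq_bigr => j _; rewrite -/(B i); ring.
under eq_bigr do rewrite bE mulrBl.
rewrite sumrB opprB; congr (_ - _).
  rewrite inner_derive_sum mulr_sumr; apply: eq_bigr => l _; rewrite -/(B l); ring.
rewrite -[in RHS]dmetric_sym inner_tr [w in RHS]row_sum_delta.
rewrite /inner !mulmx_suml summxE; apply: eq_bigr => l _.
by rewrite -!scalemxAl [RHS]mxE mulrC.
Qed.

Lemma is_derive_metric (I : set R) gamma (s : R) : geodesic P I gamma -> I s ->
  is_derive s (1 : R) (fun t => P (gamma t)) ('D_(derive1 gamma s) P (gamma s)).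
Proof.
move=> geo Is; have [dg _ _] := geodesicP geo Is.
exact: is_derive_comp1 (metric_differentiable _) dg.
Qed.

(** The derivative of P along the geodesic cancels against the acceleration, leaving half
the derivative of P in the direction V and the term in V'. Used with V a linear
interpolation (variation of length) and with V = f (Lie derivative). *)
Lemma first_variation (I : set R) gamma (V : R -> 'rV[R]_n) (s : R) dV :
  geodesic P I gamma -> I s -> is_derive s (1 : R) V dV ->
  is_derive s (1 : R) (fun t => inner (P (gamma t)) (derive1 gamma t) (V t))
    (2^-1 * inner ('D_(V s) P (gamma s)) (derive1 gamma s) (derive1 gamma s)
     + inner (P (gamma s)) (derive1 gamma s) dV).
Proof.
move=> geo Is dVs; have [_ ddg _] := geodesicP geo Is.
have H := is_derive_inner (is_derive_metric geo Is) ddg dVs.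
apply: (is_derive_congr H) => //.
by rewrite inner_accel addrCA subrr addr0.
Qed.

End first_variation.

(** * Length and distance *)

Section length.
Context {R : realType} {n : nat} (P : 'rV[R]_n -> 'M[R]_n).
Hypotheses (P_metric : riemannian_metric P) (P_C2 : Ck 2 P).

Lemma metric_continuous : continuous P.
Proof. by move=> x; apply: differentiable_continuous; exact: metric_differentiable. Qed.

Lemma C1_curve (c dc : R -> 'rV[R]_n) :
  (forall s : R, is_derive s (1 : R) c (dc s)) -> continuous dc ->
  Ck 1 c /\ derive1 c = dc.
Proof.
move=> cd dcc; split; last first.
  by apply/funext => s; rewrite derive1E; have [_ ->] := cd s.
have dfc (s : R) : differentiable c s.
  by apply/derivable1_diffP; have [] := cd s.
split=> // v.
have -> : (fun x : R => 'D_v c x) = (fun x => v *: dc x).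
  apply/funext => s; rewrite deriveE//.
  have [_ <-] := cd s; rewrite deriveE// -[v in LHS]mulr1.
  exact: linearZ.
by move=> s; apply: cvgZ; [exact: cvg_cst|exact: dcc].
Qed.

Lemma path_length_ge0 (c : R -> 'rV[R]_n) a b : 0 <= path_length P c a b.
Proof. by apply: Rintegral_ge0 => s _; exact: sqrtr_ge0. Qed.

Lemma dist_le_length (c : R -> 'rV[R]_n) a b : piecewise_C1 c a b ->
  dist P (c a) (c b) <= path_length P c a b.
Proof.
move=> pc; rewrite /dist.
set L := (X in inf X); have lb : has_lbound L.
  by exists 0 => l [s1 [s2 [g [_ _ _ ->]]]]; exact: path_length_ge0.
by apply: (ge_inf lb); exists a, b, c.
Qed.

(** Bounding the speed by a derivative makes the length computable by the fundamental
theorem of calculus, so no integral appears in the sequel. *)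
Lemma dist_le_primitive (c dc : R -> 'rV[R]_n) (psi dpsi : R -> R) (a b : R) :
  a < b -> (forall s : R, is_derive s (1 : R) c (dc s)) -> continuous dc ->
  (forall s : R, is_derive s (1 : R) psi (dpsi s)) -> continuous dpsi ->
  (forall s, a <= s <= b -> Num.sqrt (inner (P (c s)) (dc s) (dc s)) <= dpsi s) ->
  dist P (c a) (c b) <= psi b - psi a.
Proof.
move=> ab cd dcc psid dpsic speed.
have [C1c c'] := C1_curve cd dcc.
have cc : continuous c by move=> s; exact: is_derive_continuous (cd s).
have pc : piecewise_C1 c a b by exact: (piecewise_C1_piece ab C1c).
apply: (le_trans (dist_le_length pc)).
pose mu := @lebesgue_measure R.
have sc : continuous (fun s => Num.sqrt (inner (P (c s)) (dc s) (dc s))).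
  move=> s.
  have ic : {for s, continuous (fun s => inner (P (c s)) (dc s) (dc s))}.
    apply: cvg_inner; [|exact: dcc|exact: dcc].
    apply: (@continuous_comp _ _ _ c P); first exact: cc.
    exact: metric_continuous.
  apply: (@continuous_comp _ _ _ (fun s => inner (P (c s)) (dc s) (dc s))
    (@Num.sqrt R)); first exact: ic.
  exact: sqrt_continuous.
have i1 : mu.-integrable `[a, b]
    (EFin \o (fun s => Num.sqrt (inner (P (c s)) (dc s) (dc s)))).
  apply: continuous_compact_integrable; first exact: segment_compact.
  by apply: continuous_subspaceT; exact: sc.
have i2 : mu.-integrable `[a, b] (EFin \o dpsi).
  apply: continuous_compact_integrable; first exact: segment_compact.
  by apply: continuous_subspaceT; exact: dpsic.
have -> : psi b - psi a = \int[mu]_(s in `[a, b]) dpsi s.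
  rewrite /Rintegral (@continuous_FTC2 R dpsi psi a b ab)//.
  - by apply: continuous_subspaceT; exact: dpsic.
  - have psic (s : R) : psi @ s --> psi s by exact: is_derive_continuous (psid s).
    split; first by move=> s _; have [] := psid s.
      by apply: cvg_at_right_filter; exact: psic.
    by apply: cvg_at_left_filter; exact: psic.
  - by move=> s _; rewrite derive1E; have [_ ->] := psid s.
rewrite /path_length c'; apply: le_Rintegral => //.
Qed.

Lemma dist_minimal_geodesic gamma (a b : R) : minimal_geodesic P gamma a b ->
  dist P (gamma a) (gamma b) = b - a.
Proof.
move=> [ab [I [geo abI]] <-]; rewrite /path_length.
rewrite (@eq_Rintegral _ _ _ _ _ (fun=> 1)); last first.
  move=> s; rewrite inE => /abI Is.
  by have [_ _ ->] := geodesicP geo Is; rewrite sqrtr1.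
rewrite Rintegral_cst// mul1r.
have := @lebesgue_measure_itv R `[a, b]; rewrite /= lte_fin => ->.
move: ab; rewrite le_eqVlt => /predU1P[->|ab]; first by rewrite ltxx subrr.
by rewrite ab -EFinB.
Qed.

(** Length is replaced by energy: the bound is an equality at x = 1, the speed of the
unperturbed geodesic, so nothing is lost to first order. *)
Lemma sqrt_le_half (x : R) : 0 <= x -> Num.sqrt x <= 2^-1 * (1 + x).
Proof.
move=> x0; rewrite -{2}(sqr_sqrtr x0).
have := sqr_ge0 (Num.sqrt x - 1).
set y := Num.sqrt x; rewrite sqrrB mulr1 expr1n; lra.
Qed.

Lemma metric_taylor (r : R) : exists K, 0 <= K /\ forall x v, `|x| <= r ->
  `|x + v| <= r -> [/\ `|P (x + v) - P x - 'D_v P x| <= K * `|v| ^+ 2,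
    `|P (x + v) - P x| <= K * `|v| & `|P (x + v)| <= K].
Proof.
have /choice[K HK] : forall ij : 'I_n * 'I_n, exists K, 0 <= K /\
    forall x v, `|x| <= r -> `|x + v| <= r ->
    `|P (x + v) ij.1 ij.2 - P x ij.1 ij.2 - 'D_v (fun x => P x ij.1 ij.2) x|
      <= K * `|v| ^+ 2.
  by move=> [i j]; have [K K0 PK] := C2_taylor (Ck_coord i j P_C2) r; exists K.
have K0 ij : 0 <= K ij by have [] := HK ij.
have [L L0 PL] := metric_lip P_C2 r.
have [M M0 PM] := lip_bounded (metric_lip P_C2) r.
pose S := \sum_ij K ij; have S0 : 0 <= S by apply: sumr_ge0 => ij _; exact: K0.
have LS : L <= S + L + M by rewrite -addrA addrCA lerDl addr_ge0.
have MS : M <= S + L + M by rewrite lerDr addr_ge0.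
have SS : S <= S + L + M by rewrite -addrA lerDl addr_ge0.
exists (S + L + M); split; first by rewrite !addr_ge0.
move=> x v xr xvr; split.
- apply: (@le_trans _ _ (S * `|v| ^+ 2)); last by rewrite ler_wpM2r// exprn_ge0.
  apply: mx_norm_le => [|i j]; first by rewrite mulr_ge0// exprn_ge0.
  have [_ /(_ x v xr xvr) /= Kij] := HK (i, j).
  rewrite !mxE -derive_mx_coord; last exact: metric_differentiable.
  rewrite (le_trans Kij)// ler_wpM2r ?exprn_ge0//.
  rewrite /S (bigD1 (i, j))//= lerDl; apply: sumr_ge0 => ij _; exact: K0.
- have := PL _ _ xvr xr; rewrite [x + v - x]addrC addKr => /le_trans; apply.
  by rewrite ler_wpM2r.
- by rewrite (le_trans (PM _ xvr)).
Qed.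

End length.

(** * Variation of the distance and Dini derivatives *)

Section variation.
Context {R : realType} {n : nat} (P : 'rV[R]_n -> 'M[R]_n).
Hypotheses (P_metric : riemannian_metric P) (P_C2 : Ck 2 P).

Lemma dmetric_continuous (g V : R -> 'rV[R]_n) : continuous g -> continuous V ->
  continuous (fun s => 'D_(V s) P (g s)).
Proof.
move=> cg cV s; have [_ cD] := P_C2.
have -> : (fun s => 'D_(V s) P (g s)) =
    (fun s => \sum_i V s 0 i *: 'D_(delta_mx 0 i) P (g s)).
  by apply/funext => t; rewrite (derive_coord (V t) (metric_differentiable P_C2 (g t))).
apply: cvg_sumr => i; apply: cvgZ.
  apply: (@continuous_comp _ _ _ V (fun x : 'rV[R]_n => x 0 i)); first exact: cV.
  exact: coord_continuous.
apply: (@continuous_comp _ _ _ g (fun x => 'D_(delta_mx 0 i) P x)); first exact: cg.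
have [dD _] := cD (delta_mx 0 i).
exact: differentiable_continuous.
Qed.

(** The endpoints of a geodesic are moved by e and g; as competitor take the geodesic plus
the linear interpolation V between e and g. Its energy differs from 1 by twice the
derivative of <gamma', V>, by first_variation, up to a quadratic error. *)
Lemma variation_length gamma (a b : R) : geodesic P setT gamma -> a < b ->
  exists2 K, 0 <= K & forall e g, `|e| <= 1 -> `|g| <= 1 ->
  dist P (gamma a + e) (gamma b + g) <=
    (b - a) + inner (P (gamma b)) (derive1 gamma b) g
    - inner (P (gamma a)) (derive1 gamma a) e + K * (`|e| + `|g|) ^+ 2.
Proof.
move=> geo ab.
have ba0 : 0 < b - a by rewrite subr_gt0.
have gd (s : R) : is_derive s (1 : R) gamma (derive1 gamma s).
  by have [] := geodesicP geo (I : setT s).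
have gdd (s : R) : is_derive s (1 : R) (derive1 gamma)
    (accel P (gamma s) (derive1 gamma s)).
  by have [] := geodesicP geo (I : setT s).
have un s : inner (P (gamma s)) (derive1 gamma s) (derive1 gamma s) = 1.
  by have [] := geodesicP geo (I : setT s).
have gc : continuous gamma by move=> s; exact: is_derive_continuous (gd s).
have gc' : continuous (derive1 gamma) by move=> s; exact: is_derive_continuous (gdd s).
have [r r0 gr] := curve_bounded a b gc.
have [w w0 gw] := curve_bounded a b gc'.
have [K [K0 PK]] := metric_taylor P_C2 (r + 1).
pose l := (b - a)^-1.
have l0 : 0 <= l by rewrite invr_ge0 ltW.
pose N2 : R := n%:R ^+ 2.
have N20 : 0 <= N2 by rewrite exprn_ge0.
pose K2 := N2 * K * (w ^+ 2 + w * l + l ^+ 2).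
have K20 : 0 <= K2.
  by apply: mulr_ge0; [exact: mulr_ge0|rewrite !addr_ge0 ?exprn_ge0 ?mulr_ge0].
exists (K2 * (b - a)); first by rewrite mulr_ge0 ?(ltW ba0).
move=> e g e1 g1.
pose eps := `|e| + `|g|.
have eps0 : 0 <= eps by rewrite addr_ge0.
pose dV := l *: (g - e).
pose V (s : R) := (e - (a * l) *: (g - e)) + s *: dV.
have dVn : `|dV| <= l * eps.
  rewrite /dV normrZ ger0_norm// ler_wpM2l// /eps [leRHS]addrC.
  exact: ler_normB.
have Vd (s : R) : is_derive s (1 : R) V dV by exact: is_derive_line.
have VE s : V s = e + ((s - a) * l) *: (g - e).
  by rewrite /V /dV scalerA -addrA -scaleNr -scalerDl -mulNr -mulrDl [- a + s]addrC.
have Va : V a = e by rewrite VE subrr mul0r scale0r addr0.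
have Vb : V b = g.
  by rewrite VE /l divff ?gt_eqF// scale1r addrC subrK.
have s01 s : a <= s <= b -> 0 <= (s - a) * l <= 1.
  move=> /andP[as_ sb]; rewrite mulr_ge0 ?subr_ge0//=.
  by rewrite /l ler_pdivrMr// mul1r lerB.
have V1 s : a <= s <= b -> `|V s| <= 1.
  by move=> sab; rewrite VE; apply: segment_norm_le => //; exact: s01.
have Veps s : a <= s <= b -> `|V s| <= eps.
  move=> sab; rewrite VE; apply: segment_norm_le; last exact: s01.
    by rewrite /eps lerDl.
  by rewrite /eps lerDr.
have Vc : continuous V by move=> s; exact: is_derive_continuous (Vd s).
pose W s := inner (P (gamma s)) (derive1 gamma s) (V s).
pose dW s := 2^-1 * inner ('D_(V s) P (gamma s)) (derive1 gamma s) (derive1 gamma s)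
     + inner (P (gamma s)) (derive1 gamma s) dV.
have Wd (s : R) : is_derive s (1 : R) W (dW s).
  exact: (first_variation P_metric P_C2 geo I (Vd s)).
pose k := K2 * eps ^+ 2.
(* The leading 0 is the base point of the line to which is_derive_line applies. *)
pose psi s := W s + (0 + s *: (1 + k)).
pose dpsi s := dW s + (1 + k).
have psid (s : R) : is_derive s (1 : R) psi (dpsi s).
  exact: (is_deriveD (Wd s) (is_derive_line 0 (1 + k : R^o) s)).
have Pc : continuous (fun s => P (gamma s)).
  move=> s; apply: (@continuous_comp _ _ _ gamma P); first exact: gc.
  exact: metric_continuous.
have dWc : continuous dW.
  move=> s; apply: cvgD; last first.
    by apply: cvg_inner; [exact: Pc|exact: gc'|exact: cvg_cst].
  have ic : {for s, continuous (fun s =>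
      inner ('D_(V s) P (gamma s)) (derive1 gamma s) (derive1 gamma s))}.
    apply: cvg_inner; [|exact: gc'|exact: gc'].
    exact: dmetric_continuous.
  exact: (cvgM (cvg_cst (2^-1 : R)) ic).
have dpsic : continuous dpsi.
  by move=> s; apply: cvgD; [exact: dWc|exact: cvg_cst].
pose c (s : R) := gamma s + V s.
pose dc (s : R) := derive1 gamma s + dV.
have cd (s : R) : is_derive s (1 : R) c (dc s) by exact: is_deriveD.
have dcc : continuous dc.
  by move=> s; apply: cvgD; [exact: gc'|exact: cvg_cst].
have Pge0 x v : 0 <= inner (P x) v v.
  have [->|v0] := eqVneq v 0; first by rewrite /inner !mul0mx mxE.
  by have [_ Pp] := P_metric x; exact: ltW (Pp _ v0).
have speed s : a <= s <= b -> Num.sqrt (inner (P (c s)) (dc s) (dc s)) <= dpsi s.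
  move=> sab; apply: (le_trans (sqrt_le_half (Pge0 _ _))).
  set x := gamma s; set v := derive1 gamma s; set u := V s.
  have xr : `|x| <= r + 1 by rewrite (le_trans (gr _ sab))// lerDl.
  have xur : `|x + u| <= r + 1.
    by rewrite (le_trans (ler_normD _ _))// lerD ?(gr _ sab) ?(V1 _ sab).
  have [T1 T2 T3] := PK x u xr xur.
  have ue : `|u| <= eps by exact: Veps.
  have vw : `|v| <= w by exact: gw.
  have T1' : inner (P (x + u) - P x - 'D_u P x) v v <= N2 * K * w ^+ 2 * eps ^+ 2.
    have -> : N2 * K * w ^+ 2 * eps ^+ 2 = N2 * (K * eps ^+ 2 * w * w) by ring.
    apply: inner_le_bound => //; apply: (le_trans T1); apply: ler_wpM2l => //.
    by rewrite lerXn2r ?nnegrE.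
  have T2' : inner (P (x + u) - P x) v dV <= N2 * K * (w * l) * eps ^+ 2.
    have -> : N2 * K * (w * l) * eps ^+ 2 = N2 * (K * eps * w * (l * eps)) by ring.
    by apply: inner_le_bound => //; apply: (le_trans T2); apply: ler_wpM2l.
  have T3' : inner (P (x + u)) dV dV <= N2 * K * l ^+ 2 * eps ^+ 2.
    have -> : N2 * K * l ^+ 2 * eps ^+ 2 = N2 * (K * (l * eps) * (l * eps)) by ring.
    exact: inner_le_bound.
  (* Expansion around the unperturbed geodesic, whose speed is 1; T1', T2', T3' bound
     the remainders. *)
  have GE : inner (P (c s)) (dc s) (dc s) =
      (1 + inner ('D_u P x) v v + inner (P (x + u) - P x - 'D_u P x) v v)
      + 2 * (inner (P x) v dV + inner (P (x + u) - P x) v dV)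
      + inner (P (x + u)) dV dV.
    rewrite /c /dc -/x -/v -/u innerDl !innerDr !innerBm.
    rewrite (inner_sym P_metric (x + u) dV v).
    have := un s; rewrite -/x -/v => ->; ring.
  rewrite GE /dpsi /dW -/x -/v -/u /k /K2.
  have h1 : 0 <= N2 * K * w ^+ 2 * eps ^+ 2 by rewrite !mulr_ge0 ?exprn_ge0.
  have h3 : 0 <= N2 * K * l ^+ 2 * eps ^+ 2 by rewrite !mulr_ge0 ?exprn_ge0.
  have -> : N2 * K * (w ^+ 2 + w * l + l ^+ 2) * eps ^+ 2 =
    N2 * K * w ^+ 2 * eps ^+ 2 + N2 * K * (w * l) * eps ^+ 2
    + N2 * K * l ^+ 2 * eps ^+ 2 by ring.
  lra.
have := dist_le_primitive P_C2 ab cd dcc psid dpsic speed.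
rewrite /c Va Vb => /le_trans; apply.
rewrite /psi /W Va Vb /k /GRing.scale/=.
rewrite le_eqVlt; apply/orP; left; apply/eqP; rewrite /eps; ring.
Qed.

(** Length of the straight segment. It replaces variation_length when the two points
coincide and there is no geodesic to vary. *)
Lemma dist_le_norm (r : R) : exists2 K, 0 <= K & forall x y,
  `|x| <= r -> `|y| <= r -> dist P x y <= K * `|y - x|.
Proof.
have [M M0 PM] := lip_bounded (metric_lip P_C2) r.
pose K := Num.sqrt (n%:R ^+ 2 * M); exists K; first exact: sqrtr_ge0.
move=> x y xr yr.
have h0 : 0 <= n%:R ^+ 2 * M by rewrite mulr_ge0// exprn_ge0.
have := @dist_le_primitive R n P P_C2 (fun s => x + s *: (y - x))
  (fun=> y - x) (fun s => 0 + s *: (K * `|y - x|)) (fun=> K * `|y - x|) 0 1 ltr01.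
rewrite scale0r addr0 scale1r [x + _]addrC subrK !add0r /GRing.scale/= mul1r mul0r subr0.
apply.
- by move=> s; exact: is_derive_line.
- by move=> s; exact: cvg_cst.
- by move=> s; exact: (is_derive_line 0 (K * `|y - x| : R^o) s).
- by move=> s; exact: cvg_cst.
move=> s s01.
have -> : K * `|y - x| = Num.sqrt (n%:R ^+ 2 * M * `|y - x| ^+ 2).
  by rewrite sqrtrM// sqrtr_sqr normr_id.
apply: ler_wsqrtr.
have -> : n%:R ^+ 2 * M * `|y - x| ^+ 2 =
  n%:R ^+ 2 * (M * `|y - x| * `|y - x|) by ring.
by apply: inner_le_bound => //; apply: PM; exact: segment_norm_le.
Qed.

End variation.

Section dini.
Context {R : realType}.

Lemma upper_dini_le (g Q : R -> R) D :
  (\forall t \near 0^'+, (g t - g 0) / t <= Q t) -> Q t @[t --> 0^'+] --> D ->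
  (upper_dini g <= D%:E)%E.
Proof.
move=> gQ QD; apply/lee_addgt0Pr => e e0.
have H : \forall t \near (0 : R)^'+, (g t - g 0) / t <= D + e.
  near=> t; apply: (@le_trans _ _ (Q t)); first by near: t.
  apply: ltW; near: t; apply: (cvgr_lt _ QD).
  by rewrite ltrDl.
rewrite /upper_dini limf_esupE -EFinD.
apply: (@le_trans _ _ (ereal_sup ((fun t => ((g t - g 0) / t)%:E) @`
   [set t | (g t - g 0) / t <= D + e]))).
  apply: ereal_inf_lbound; exists [set t | (g t - g 0) / t <= D + e] => //.
apply: ge_ereal_sup => _ [t /= tDe <-].
by rewrite lee_fin.
Unshelve. all: by end_near. Qed.

Lemma right_continuous0 n (X : R -> 'rV[R]_n) (T : R) : 0 < T ->
  {within `[0, T[, continuous X} -> X t @[t --> 0^'+] --> X 0.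
Proof.
move=> T0 cX.
have T2 : 0 < T / 2 by rewrite divr_gt0.
have : {within `[0, T / 2], continuous X}.
  apply: continuous_subspaceW cX => t; rewrite /= !in_itv/= => /andP[-> tT].
  by rewrite (le_lt_trans tT)// ltr_pdivrMr// ltr_pMr// ltr1n.
by move/(continuous_within_itvP _ T2) => [].
Qed.

(** The equation is only assumed for positive times; the mean value theorem recovers the
right derivative at 0 from the right limit of the derivative. *)
Lemma right_derivative n (X phi : R -> 'rV[R]_n) (T : R) (phi0 : 'rV[R]_n) : 0 < T ->
  {within `[0, T[, continuous X} ->
  (forall t : R, 0 < t < T -> is_derive t (1 : R) X (phi t)) ->
  phi t @[t --> 0^'+] --> phi0 ->
  t^-1 *: (X t - X 0) @[t --> 0^'+] --> phi0.
Proof.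
move=> T0 cX dX phic; apply/cvgrPdist_le => e e0.
have /cvgrPdist_le/(_ e e0) phie := phic.
have [d /= d0 dphi] : exists2 d, 0 < d & forall s, 0 < s < d -> `|phi0 - phi s| <= e.
  move: phie; rewrite /at_right /within/= => /nbhs_ballP[d /= d0 dP].
  exists d => // s /andP[s0 sd]; apply: dP => //.
  by rewrite /ball/= sub0r normrN gtr0_norm.
near=> t.
have t0 : 0 < t by near: t; exact: nbhs_right_gt.
have tT : t < T by near: t; exact: nbhs_right_lt.
have td : t < d by near: t; exact: nbhs_right_lt.
pose u (s : R) := X s - (0 + s *: phi0).
have du s : 0 < s < t -> is_derive s (1 : R) u (phi s - phi0).
  move=> /andP[s0 st].
  have dXs : is_derive s (1 : R) X (phi s) by apply: dX; rewrite s0 (lt_trans st).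
  exact: is_deriveB dXs (is_derive_line 0 phi0 s).
have cu : {within `[0, t], continuous u}.
  have cXt : {within `[0, t], continuous X}.
    apply: continuous_subspaceW cX => s; rewrite /= !in_itv/= => /andP[-> st].
    exact: le_lt_trans tT.
  have cl : {within `[0, t], continuous (fun s : R => 0 + s *: phi0)}.
    apply: continuous_subspaceT => s.
    exact: is_derive_continuous (is_derive_line 0 phi0 s).
  by move=> s; apply: cvgB; [exact: cXt|exact: cl].
have := mvt_norm_oo (ltW t0) cu du (M := e) _ (ltW e0).
rewrite /u scale0r !addr0 !subr0 add0r => H.
have -> : phi0 - t^-1 *: (X t - X 0) = - (t^-1 *: (X t - t *: phi0 - X 0)).
  rewrite [X t - _ - _]addrAC (scalerBr _ _ (t *: phi0)) scalerA mulVf ?gt_eqF//.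
  by rewrite scale1r [RHS]opprB.
rewrite normrN normrZ gtr0_norm ?invr_gt0// ler_pdivrMl// mulrC; apply: H.
move=> s /andP[s0 st]; rewrite distrC; apply: dphi.
by rewrite s0 (lt_trans st).
Unshelve. all: by end_near. Qed.

End dini.

(** * Algebra of the observer *)

Section jacobians.
Context {R : realType}.

Lemma jacobian_comp n m p (f : 'rV[R]_n -> 'rV[R]_m) (g : 'rV[R]_m -> 'rV[R]_p) x :
  differentiable f x -> differentiable g (f x) ->
  jacobian (fun x => g (f x)) x = jacobian f x *m jacobian g (f x).
Proof.
move=> df dg; apply: jacobian_eq; first exact: (differentiable_comp df dg).
move=> v; rewrite mulmxA.
rewrite -(deriveEjacobian v df) -(deriveEjacobian _ dg).
rewrite (deriveE _ (differentiable_comp df dg)) (deriveE _ df) (deriveE _ dg).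
by rewrite diff_comp.
Qed.

Lemma jacobian_id n (x : 'rV[R]_n) : jacobian (fun x : 'rV[R]_n => x) x = 1%:M.
Proof.
apply: jacobian_eq; first exact: ex_diff.
by move=> v; rewrite mulmx1; exact: derive_id.
Qed.

(** The factor 2 of this gradient is why the gain appears as 2 k below. *)
Lemma grad1_sqdist m (y1 y2 : 'rV[R]_m) :
  grad1 (@sqdist R m) y1 y2 = 2 *: (y1 - y2).
Proof.
apply/rowP => j; rewrite !mxE /partial.
pose dz (i : 'I_m) : R := delta_mx 0 j 0 i.
have D (i : 'I_m) : is_derive y1 (delta_mx 0 j)
    (fun z : 'rV[R]_m => (z 0 i - y2 0 i) ^+ 2)
    (2 * (y1 0 i - y2 0 i) * (delta_mx 0 j : 'rV[R]_m) 0 i).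
  have /is_derive_mxP/(_ 0 i) c := is_derive_id y1 (delta_mx 0 j : 'rV[R]_m).
  have cB := is_deriveB c (is_derive_cst (y2 0 i) y1 (delta_mx 0 j)).
  apply: (is_derive_congr (is_deriveX 2 cB)) => //.
  by rewrite subr0.
have -> : (fun z => sqdist z y2) =
    \sum_i (fun z : 'rV[R]_m => (z 0 i - y2 0 i) ^+ 2).
  by apply/funext => z; rewrite fct_sumE.
have [_ ->] := is_derive_sum D.
rewrite (bigD1 j)//= mxE !eqxx mulr1 big1 ?addr0// => i ij.
by rewrite mxE (negPf ij) andbF mulr0.
Qed.

(** With J the Jacobian of phi, the chain rule gives h' = J hb' and the change of metric
gives P^-1 = J^-T Pb^-1 J^-1, so that the factors J cancel in h'^T P^-1 J. *)
Lemma intrinsic_observer n m (delta : 'rV[R]_m -> 'rV[R]_m -> R)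
    (P : 'rV[R]_n -> 'M[R]_n) f h k :
  (forall x, P x \in unitmx) -> Ck 1 h ->
  intrinsic delta P f h k (observer delta P f h k).
Proof.
move=> Pu [dh _] phi [psi [phiK psiK [dphi _] [dpsi _]]] hb kb fb Fb Pb.
move=> hbE kbE fbE FbE PE x y.
rewrite FbE /observer fbE kbE hbE.
have hbpsi : hb = fun z => h (psi z).
  by apply/funext => z; rewrite -[z in LHS]psiK hbE.
have dhb : differentiable hb (phi x).
  rewrite hbpsi; apply: differentiable_comp; first exact: dpsi.
  exact: dh.
have Jh : jacobian h x = jacobian phi x *m jacobian hb (phi x).
  have H := jacobian_comp (dphi x) dhb.
  have E : (fun x => hb (phi x)) = h by apply/funext => z; rewrite hbE.
  by rewrite E in H.
have Jpsi : jacobian phi x *m jacobian psi (phi x) = 1%:M.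
  have H := jacobian_comp (dphi x) (dpsi (phi x)).
  have E : (fun x => psi (phi x)) = (fun x => x) by apply/funext => z; rewrite phiK.
  by rewrite E jacobian_id in H.
have PEx := PE x; move: Jh Jpsi PEx.
move: (jacobian h x) (jacobian phi x) (jacobian hb (phi x)) (jacobian psi (phi x)).
move=> Jh J Jhb Jp JhE JJp PEx.
have Ju : J \in unitmx by have [] := mulmx1_unit JJp.
have JTu : J^T \in unitmx by rewrite unitmx_tr.
have Pbu : Pb (phi x) \in unitmx.
  by have := Pu x; rewrite PEx !unitmx_mul => /andP[/andP[]].
rewrite mulmxBl -scalemxAl; congr (_ - _ *: _).
rewrite JhE PEx trmx_mul.
have -> : invmx (J *m Pb (phi x) *m J^T) = invmx J^T *m invmx (Pb (phi x)) *m invmx J.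
  apply: (@row_free_inj _ _ _ _ (J *m Pb (phi x) *m J^T)).
    by rewrite row_free_unit !unitmx_mul Ju Pbu JTu.
  rewrite mulVmx ?unitmx_mul ?Ju ?Pbu ?JTu//.
  by rewrite !mulmxA mulmxKV// mulmxKV// mulVmx.
by rewrite !mulmxA mulmxKV// mulmxK.
Qed.

(** The inverse metric in the correction cancels the metric of the inner product: what
remains is the output error times the output rate. *)
Lemma inner_observer n (P : 'rV[R]_n -> 'M[R]_n) f (h : 'rV[R]_n -> 'rV[R]_1) k x v y :
  riemannian_metric P -> Ck 1 h ->
  inner (P x) v (observer (@sqdist R 1) P f h k x y - f x) =
  - (2 * k x * (h x 0 0 - y 0 0) * output_rate h (row_mx x v)).
Proof.
move=> Pm hC1; rewrite (output_rateE hC1) /observer grad1_sqdist.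
rewrite addrC addKr /inner linearN mulmxN [LHS]mxE; congr (- _).
rewrite linearZ -scalemxAr [LHS]mxE.
rewrite -scalemxAl -scalemxAl linearZ -scalemxAr [X in _ * X]mxE.
rewrite /= !trmx_mul trmxK trmx_inv metric_sym//.
rewrite !mulmxA mulmxK ?metric_unitmx//.
rewrite [X in _ * (_ * X) = _]mxE big_ord1 !mxE; ring.
Qed.

End jacobians.

(** * A continuous gain and the output along geodesics *)

Section majorant.
Context {R : realType}.

(** The tent-like terms max 0 (|x| + 2 - i) vanish for i large, so the sum is locally a
fixed finite sum, hence continuous; the term of index N is at least kappa N as soon
as |x| is at least N - 1. *)
Lemma continuous_majorant n (kappa : nat -> R) :
  exists k : 'rV[R]_n -> R, [/\ continuous k, forall x, 0 < k x &
    forall x, exists2 N, `|x| <= N%:R & kappa N <= k x].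
Proof.
pose A (N : nat) (r : R) := 1 + \sum_(i < N) `|kappa i| * Num.max 0 (r + 2 - i%:R).
have AE N M r : (N <= M)%N -> r + 2 <= N%:R -> A M r = A N r.
  move=> NM rN; rewrite /A; congr (1 + _).
  rewrite -(subnKC NM) big_split_ord/= [X in _ + X]big1 ?addr0// => i _.
  rewrite (max_idPl _) ?mulr0// subr_le0 (le_trans rN)// natrD lerDl//.
have Apos N r : 0 < A N r.
  rewrite ltr_pwDl// sumr_ge0// => i _; rewrite mulr_ge0//.
  by rewrite le_max lexx.
have Ac N : continuous (A N).
  move=> r; apply: cvgD; first exact: cvg_cst.
  apply: cvg_sumr => i.
  have mc : {for r, continuous (fun r : R => Num.max 0 (r + 2 - i%:R))}.
    apply: continuous_max; first exact: cst_continuous.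
    apply: cvgB; last exact: cvg_cst.
    by apply: cvgD; [exact: cvg_id|exact: cvg_cst].
  exact: (cvgM (cvg_cst `|kappa i|) mc).
pose N0 (x : 'rV[R]_n) := (Num.truncn `|x|).+1.
have tr (x : 'rV[R]_n) : (N0 x).-1%:R <= `|x| < (N0 x)%:R.
  exact: truncn_itv.
have AN0 (x : 'rV[R]_n) M : ((N0 x).+2 <= M)%N -> A M `|x| = A (N0 x).+2 `|x|.
  move=> NM; apply: AE => //.
  have /andP[_ /ltW xN] := tr x.
  by rewrite -!natr1 in xN *; lra.
exists (fun x => A (N0 x).+2 `|x|); split.
- move=> x.
  pose M := (N0 x).+3.
  have near_eq : \forall y \near x, A M `|y| = A (N0 y).+2 `|y|.
    apply/nbhs_ballP; exists 1 => //= y; rewrite -ball_normE/= => xy.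
    apply: AN0; rewrite /M !ltnS.
    have yx : `|y| < (N0 x)%:R + 1.
      have /andP[_ xN] := tr x.
      rewrite -[y](subKr x) (le_lt_trans (ler_normB _ _))//.
      exact: ltrD.
    rewrite natr1 in yx.
    have /andP[yN _] := tr y.
    by have := le_lt_trans yN yx; rewrite ltr_nat.
  apply: (@cvg_trans _ ((fun y : 'rV[R]_n => A M `|y|) @ x)).
    apply: near_eq_cvg; first exact: nbhs_filter.
    by move: near_eq; apply: filterS => y ->.
  rewrite -(AN0 x M)//.
  apply: (@continuous_comp _ _ _ (fun y : 'rV[R]_n => `|y|) (A M)).
    exact: norm_continuous.
  exact: Ac.
- by move=> x; exact: Apos.
- move=> x; exists (N0 x); first by have /andP[_ /ltW] := tr x.
  have NM : (N0 x < (N0 x).+2)%N by [].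
  rewrite /A (bigD1 (Ordinal NM))//= (le_trans (ler_norm _))//.
  rewrite addrCA; apply: ler_wpDr.
    rewrite addr_ge0// sumr_ge0// => i _; rewrite mulr_ge0//.
  rewrite ler_peMr// le_max; apply/orP; right.
  have /andP[xN _] := tr x; move: xN; rewrite /N0 /= => xN.
  by rewrite -natr1; lra.
Qed.

Lemma cvg_mx_coord (T : Type) (F : set_system T) m n (A : T -> 'M[R]_(m, n)) (A0 : 'M[R]_(m, n)) :
  Filter F -> (forall i j, A t i j @[t --> F] --> A0 i j) -> A t @[t --> F] --> A0.
Proof.
move=> FF Aij; rewrite [A0]matrix_sum_delta.
have -> : A = fun t => \sum_(i < m) \sum_(j < n) A t i j *: delta_mx i j.
  by apply/funext => t; rewrite [LHS]matrix_sum_delta.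
apply: cvg_sumr => i; apply: cvg_sumr => j.
by apply: cvgZ; [exact: Aij|exact: cvg_cst].
Qed.

Lemma cvg_trmx (T : Type) (F : set_system T) m n (A : T -> 'M[R]_(m, n))
    (A0 : 'M[R]_(m, n)) : Filter F ->
  A t @[t --> F] --> A0 -> (A t)^T @[t --> F] --> A0^T.
Proof.
move=> FF cA; apply: cvg_mx_coord => i j; rewrite mxE.
under eq_fun do rewrite mxE.
exact: (cvg_comp A (fun B : 'M[R]_(m, n) => B j i) cA (@coord_continuous _ _ _ j i A0)).
Qed.

Lemma cvg_mulmx (T : Type) (F : set_system T) m n p (A : T -> 'M[R]_(m, n))
    (B : T -> 'M[R]_(n, p)) (A0 : 'M[R]_(m, n)) (B0 : 'M[R]_(n, p)) : Filter F ->
  A t @[t --> F] --> A0 -> B t @[t --> F] --> B0 ->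
  (A t *m B t) @[t --> F] --> A0 *m B0.
Proof.
move=> FF cA cB; apply: cvg_mx_coord => i j; rewrite mxE.
under eq_fun do rewrite mxE.
apply: cvg_sumr => k.
have cAik := cvg_comp A (fun C : 'M[R]_(m, n) => C i k) cA (@coord_continuous _ _ _ i k A0).
have cBkj := cvg_comp B (fun C : 'M[R]_(n, p) => C k j) cB (@coord_continuous _ _ _ k j B0).
exact: (cvgM cAik cBkj).
Qed.

(** The hypothesis of the intermediate value theorem for two values of opposite signs. *)
Lemma min_max_of_mul_lt0 (x y : R) : x * y < 0 -> Num.min x y <= 0 <= Num.max x y.
Proof.
move=> neg; rewrite ge_min le_max.
have [x0|x0] := leP x 0.
  have [y0|/ltW y0] := leP y 0; last by rewrite y0 !orbT.
  by move: neg; rewrite ltNge mulr_le0.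
have [y0|/ltW y0] := leP y 0; first by rewrite (ltW x0) orbT.
by move: neg; rewrite ltNge mulr_ge0// ltW.
Qed.

Lemma drift_arith (k q x1 x2 x3 x4 : R) : x1 <= x2 * x3 ^+ 2 - q ->
  2^-1 * x2 * x3 ^+ 2 <= q / 4 + 2 * k * (x3 * x4) ->
  2^-1 * x1 - 2 * k * x4 * x3 <= - (q / 4).
Proof.
have -> : 2^-1 * x2 * x3 ^+ 2 = 2^-1 * (x2 * x3 ^+ 2) by ring.
have -> : 2 * k * (x3 * x4) = 2 * k * x4 * x3 by ring.
lra.
Qed.

End majorant.

Section observer_along_geodesics.
Context {R : realType} {n : nat} (P : 'rV[R]_n -> 'M[R]_n).
Hypotheses (P_metric : riemannian_metric P) (P_C2 : Ck 2 P).
Hypothesis P_complete : complete_metric P.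
Context (f : 'rV[R]_n -> 'rV[R]_n) (f_C1 : Ck 1 f).
Context (h : 'rV[R]_n -> 'rV[R]_1) (h_C1 : Ck 1 h).
Context (C : set 'rV[R]_n).
Hypothesis level_tg : forall y, (h @` C) y ->
  totally_geodesic P (fun x => h x - y) C.

Let rate gamma s := output_rate h (state gamma s).

Lemma rate_continuous gamma : geodesic P setT gamma -> continuous (rate gamma).
Proof.
move=> geo t; apply: (@continuous_comp _ _ _ (state gamma) (output_rate h)).
  exact: (state_continuous geo).
exact: output_rate_continuous.
Qed.

(** By the intermediate value theorem a change of sign would produce a zero, and then the
rate vanishes identically. *)
Lemma rate_same_sign gamma (a b r s : R) : geodesic P setT gamma ->
  (forall t, a <= t <= b -> C (gamma t)) -> a <= r <= b -> a <= s <= b ->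
  0 <= rate gamma r * rate gamma s.
Proof.
move=> geo stay.
wlog rs : r s / r <= s.
  move=> H rab sab; have [rs|/ltW sr] := leP r s; first exact: H.
  by rewrite mulrC; exact: H.
move=> rab sab; rewrite leNgt; apply/negP => neg.
have cr : {within `[r, s], continuous (rate gamma)}.
  apply: continuous_subspaceT; exact: rate_continuous.
have zero : Num.min (rate gamma r) (rate gamma s) <= 0 <=
    Num.max (rate gamma r) (rate gamma s).
  exact: min_max_of_mul_lt0 neg.
have [t trs t0] := IVT rs cr zero.
have tab : a <= t <= b.
  move: trs; rewrite in_itv/= => /andP[rt ts].
  by case/andP: rab => ar _; case/andP: sab => _ sb; rewrite (le_trans ar rt) (le_trans ts sb).
have r0 := output_rate_zero h_C1 level_tg geo stay tab t0 rab.
by move: neg; rewrite (r0 : rate gamma r = 0) mul0r ltxx; move/negP; apply.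
Qed.

Lemma output_increment gamma (a b : R) : geodesic P setT gamma -> a < b ->
  exists2 c, a < c < b &
    h (gamma b) 0 0 - h (gamma a) 0 0 = rate gamma c * (b - a).
Proof.
move=> geo ab.
have cH : {within `[a, b], continuous (fun t => h (gamma t) 0 0)}.
  apply: derivable_within_continuous => t _.
  by have [] := is_derive_output h_C1 t geo.
have [c cab E] := MVT ab (fun t _ => is_derive_output h_C1 t geo) cH.
by exists c => //; move: cab; rewrite in_itv.
Qed.

(** The output error h (gamma s) - h (gamma 0) is s times an intermediate rate, which has
the sign of the rate at s; where the outputs differ both are nonzero. *)
Lemma gain_margin (k : 'rV[R]_n -> R) : (forall x, 0 < k x) ->
  infinite_gain_margin_on C P f h (observer (@sqdist R 1) P f h k).
Proof.
move=> kpos; split=> [x|gamma0 shat [[I [geoI I0]] _] stay0 s /andP[s0 ss] hs].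
  by rewrite /observer grad1_sqdist subrr scaler0 !mul0mx scaler0 subr0.
have [gamma [geo geq]] := P_complete geoI.
have Is r : 0 <= r < shat -> I r by move=> rs; apply: I0; rewrite /= in_itv.
have I0' : I 0 by apply: Is; rewrite lexx (lt_trans s0 ss).
have Iss : I s by apply: Is; rewrite (ltW s0) ss.
rewrite -(eq_geodesic geoI Iss geq) -(geq 0 I0') -(geq s Iss).
rewrite inner_observer// -/(state gamma s) -/(rate gamma s).
have stay r : 0 <= r <= s -> C (gamma r).
  move=> /andP[r0 rs]; have r1 : 0 <= r < shat by rewrite r0 (le_lt_trans rs ss).
  by rewrite geq; [exact: stay0|exact: Is].
have [c /andP[c0 cs] hE] := output_increment geo s0.
have sE : 0 <= s <= s by rewrite (ltW s0) lexx.
have cE : 0 <= c <= s by rewrite (ltW c0) (ltW cs).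
have hne : rate gamma c != 0.
  apply/eqP => c00; move: hE; rewrite c00 mul0r => /eqP; rewrite subr_eq0 => /eqP h0.
  move/eqP: hs; apply; rewrite -(geq 0 I0') -(geq s Iss).
  by apply/rowP => j; rewrite !ord1.
have sne : rate gamma s != 0.
  apply/eqP => s00; move/eqP: hne; apply.
  exact: (output_rate_zero h_C1 level_tg geo stay sE s00 cE).
have pos : 0 < rate gamma c * rate gamma s.
  rewrite lt0r; apply/andP; split; first exact: (mulf_neq0 hne sne).
  exact: (rate_same_sign geo stay cE sE).
rewrite oppr_lt0 hE subr0.
move: (rate gamma c) (rate gamma s) pos => x y pos.
have -> : 2 * k (gamma s) * (x * s) * y = (2 * k (gamma s) * s) * (x * y) by ring.
apply: mulr_gt0; last exact: pos.
apply: mulr_gt0; last exact: s0.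
by apply: mulr_gt0; [exact: ltr0n|exact: kpos].
Qed.

Lemma lie_formE x v : lie_form f P x v =
  inner ('D_(f x) P x) v v + 2 * inner (P x) v ('D_v f x).
Proof.
rewrite /lie_form.
have dP : is_derive x (f x) P ('D_(f x) P x).
  by apply/derivableP; apply: diff_derivable; exact: metric_differentiable.
have H := is_derive_inner dP (is_derive_cst v x (f x)) (is_derive_cst v x (f x)).
have [_ E] := H; rewrite /cst in E; rewrite E.
have [df _] := f_C1; rewrite (deriveEjacobian _ (df x)).
have z1 : inner (P x) 0 v = 0 by rewrite /inner !mul0mx mxE.
have z2 : inner (P x) v 0 = 0 by rewrite /inner trmx0 mulmx0 mxE.
by rewrite z1 z2 !addr0.
Qed.

Context (rho : 'rV[R]_n -> R) (q : R).
Hypothesis lie_le : forall x, C x -> forall v,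
  lie_form f P x v <= rho x * inner (jacobian h x *m (jacobian h x)^T) v v
    - q * inner (P x) v v.

Lemma inner_output x v :
  inner (jacobian h x *m (jacobian h x)^T) v v = output_rate h (row_mx x v) ^+ 2.
Proof.
rewrite (output_rateE h_C1) /inner mulmxA -mulmxA -trmx_mul.
by rewrite [LHS]mxE big_ord1 [X in _ * X]mxE expr2.
Qed.

(** The derivative of <gamma', f> along gamma is half the Lie derivative, bounded by
the excess minus q/2. The gain condition bounds the excess by q/4 plus a
multiple of |rate t| |rate a|; as the rates have the same sign, that multiple is
the derivative of 2 k (rate a) h (gamma t), which the observer correction cancels. *)
Lemma drift_estimate gamma (a b k : R) : geodesic P setT gamma -> a <= b ->
  (forall t, a <= t <= b -> C (gamma t)) ->
  (forall t, a <= t <= b -> excess h rho (state gamma t) <=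
     q / 4 + 2 * k * (`|rate gamma t| * `|rate gamma a|)) ->
  inner (P (gamma b)) (derive1 gamma b) (f (gamma b)) -
  inner (P (gamma a)) (derive1 gamma a) (f (gamma a)) -
  2 * k * rate gamma a * (h (gamma b) 0 0 - h (gamma a) 0 0) <=
  - (q / 4) * (b - a).
Proof.
move=> geo ab stay gain.
pose w t := inner (P (gamma t)) (derive1 gamma t) (f (gamma t)).
pose u t := w t - (2 * k * rate gamma a) * h (gamma t) 0 0.
have [df _] := f_C1.
have dw (t : R) : is_derive t (1 : R) w
    (2^-1 * lie_form f P (gamma t) (derive1 gamma t)).
  have [dg _ _] := geodesicP geo (I : setT t).
  have dfg := is_derive_comp1 (df (gamma t)) dg.
  have H := first_variation P_metric P_C2 geo I dfg.
  apply: (is_derive_congr H) => //.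
  by rewrite lie_formE mulrDr [2^-1 * (2 * _)]mulrA mulVf ?mul1r// pnatr_eq0.
have du (t : R) : is_derive t (1 : R) u
    (2^-1 * lie_form f P (gamma t) (derive1 gamma t)
      - (2 * k * rate gamma a) * rate gamma t).
  have H := is_deriveB (dw t)
    (is_deriveZ (2 * k * rate gamma a) (is_derive_output h_C1 t geo)).
  exact: (is_derive_congr H).
have cu : {within `[a, b], continuous u}.
  by apply: derivable_within_continuous => t _; have [] := du t.
have [t] := MVT_segment ab (fun t _ => du t) cu.
rewrite in_itv/= => tab uE.
have -> : inner (P (gamma b)) (derive1 gamma b) (f (gamma b)) -
  inner (P (gamma a)) (derive1 gamma a) (f (gamma a)) -
  2 * k * rate gamma a * (h (gamma b) 0 0 - h (gamma a) 0 0) = u b - u a.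
  by rewrite /u /w; ring.
rewrite uE ler_wpM2r ?subr_ge0//.
have [_ _ un] := geodesicP geo (I : setT t).
have := lie_le (stay t tab) (derive1 gamma t).
rewrite un inner_output -/(state gamma t) mulr1 -/(rate gamma t) => lie.
have sgn : 0 <= rate gamma t * rate gamma a.
  by apply: (rate_same_sign geo stay tab); rewrite lexx.
have := gain t tab; rewrite -normrM (ger0_norm sgn).
have -> : excess h rho (state gamma t) = 2^-1 * rho (gamma t) * rate gamma t ^+ 2.
  by rewrite /excess /state row_mxKl.
move: lie; move: (lie_form _ _ _ _) (rho _) (rate gamma t) (rate gamma a).
move=> x1 x2 x3 x4 lie ex.
exact: drift_arith lie ex.
Qed.

End observer_along_geodesics.

(** * Decay of the distance *)

Section decay.
Context {R : realType} {n : nat} (P : 'rV[R]_n -> 'M[R]_n).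
Hypotheses (P_metric : riemannian_metric P) (P_C2 : Ck 2 P).
Hypothesis P_complete : complete_metric P.
Context (f : 'rV[R]_n -> 'rV[R]_n) (f_C1 : Ck 1 f).
Context (h : 'rV[R]_n -> 'rV[R]_1) (h_C1 : Ck 1 h).
Context (C : set 'rV[R]_n) (C_convex : geodesically_convex P C).
Hypothesis level_tg : forall y, (h @` C) y ->
  totally_geodesic P (fun x => h x - y) C.
Context (rho : 'rV[R]_n -> R) (q : R).
Hypothesis lie_le : forall x, C x -> forall v,
  lie_form f P x v <= rho x * inner (jacobian h x *m (jacobian h x)^T) v v
    - q * inner (P x) v v.
Context (k : 'rV[R]_n -> R) (k_continuous : continuous k).

Let F := observer (@sqdist R 1) P f h k.

(** Geodesic convexity, reparametrized to start at time 0 and prolonged to the line. *)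
Lemma connecting_geodesic x1 x2 : C x1 -> C x2 ->
  exists gamma L, [/\ geodesic P setT gamma, 0 <= L /\ L = dist P x1 x2,
    gamma 0 = x1, gamma L = x2 & stays_in C gamma L].
Proof.
move=> Cx1 Cx2; have [g0 [a [b [mg ga gb stay]]]] := C_convex Cx1 Cx2.
have dE := dist_minimal_geodesic mg; rewrite ga gb in dE.
have [ab [I [geoI abI]] _] := mg.
have [g [geo geq]] := P_complete geoI.
have [geo' _] := geodesic_shift a geo.
have Is s : a <= s <= b -> I s by move=> sab; apply: abI; rewrite /= in_itv.
exists (fun t => g (t + a)), (b - a); split.
- exact: geo'.
- by split; [rewrite subr_ge0|rewrite dE].
- by rewrite add0r geq; [exact: ga|apply: Is; rewrite lexx ab].
- by rewrite subrK geq; [exact: gb|apply: Is; rewrite lexx ab].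
move=> r /andP[r0 rL].
have rab : a <= r + a <= b by rewrite lerDr r0 -lerBrDr rL.
by rewrite geq; [exact: stay|exact: Is].
Qed.

Lemma output_continuous : continuous h.
Proof. by have [dh _] := h_C1 => x; apply: differentiable_continuous. Qed.

Lemma jacobian_continuous : continuous (jacobian h).
Proof.
have [dh cD] := h_C1; move=> x; apply: cvg_mx_coord => [|i j]; first exact: nbhs_filter.
have E y : jacobian h y i j = ('D_(delta_mx 0 i) h y) 0 j.
  by rewrite (deriveEjacobian _ (dh y)) -rowE [RHS]mxE.
have c1 : {for x, continuous (fun y => ('D_(delta_mx 0 i) h y) 0 j)}.
  apply: (@continuous_comp _ _ _ (fun y => 'D_(delta_mx 0 i) h y)
    (fun z : 'rV[R]_1 => z 0 j)); first exact: cD.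
  exact: coord_continuous.
have EF : (fun y => ('D_(delta_mx 0 i) h y) 0 j) = (fun y => jacobian h y i j).
  by apply/funext => y; exact: esym (E y).
rewrite EF in c1; exact: c1.
Qed.

Lemma observer_cvg (T : Type) (G : set_system T) (X : T -> 'rV[R]_n)
    (Y : T -> 'rV[R]_1) (x : 'rV[R]_n) (y : 'rV[R]_1) : Filter G ->
  X t @[t --> G] --> x -> Y t @[t --> G] --> y ->
  F (X t) (Y t) @[t --> G] --> F x y.
Proof.
move=> FG cX cY; have [df _] := f_C1.
have cf := cvg_comp X f cX (differentiable_continuous (df x)).
have ck := cvg_comp X k cX (@k_continuous x).
have ch := cvg_comp X h cX (@output_continuous x).
have cJ := cvg_comp X (jacobian h) cX (@jacobian_continuous x).
have cP := cvg_comp X (fun z => invmx (P z)) cX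
  (lip_continuous (invP_lip P_metric P_C2) (x := x)).
have cJT : (jacobian h (X t))^T @[t --> G] --> (jacobian h x)^T.
  exact: (cvg_trmx FG cJ).
have cg : (2 *: (h (X t) - Y t)) @[t --> G] --> 2 *: (h x - y).
  by apply: cvgZ; [exact: cvg_cst|exact: cvgB ch cY].
rewrite /F /observer grad1_sqdist.
under eq_fun do rewrite grad1_sqdist.
exact: (cvgB cf (cvgZ ck (cvg_mulmx FG (cvg_mulmx FG cg cJT) cP))).
Qed.

(** The distance at time t is at most the length of the varied geodesic, whose first-order
change in t is the inner product of the velocities with gamma' at the two ends;
drift_estimate bounds that quantity. The geodesic is run from the estimate
xhat to x, so that the gain is evaluated at its starting point. *)
Lemma dini_decay (E : R) x xhat T X Xhat : C x -> C xhat ->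
  dist P xhat x < E ->
  (forall gamma s, geodesic P setT gamma -> gamma 0 = xhat -> 0 <= s <= E ->
    stays_in C gamma s -> excess h rho (state gamma s) <= q / 4 +
      2 * k xhat * (`|output_rate h (state gamma s)| * `|output_rate h (state gamma 0)|)) ->
  0 < T -> X 0 = x -> Xhat 0 = xhat ->
  solution (fun=> f) T X -> solution (fun t z => F z (h (X t))) T Xhat ->
  (upper_dini (fun t => dist P (Xhat t) (X t)) <= (- (q / 4) * dist P xhat x)%:E)%E.
Proof.
move=> Cx Cxhat dE gain T0 X0 Xh0 [cX dX] [cXh dXh].
have [gamma [L [geo [L0 LE] g0 gL stay]]] := connecting_geodesic Cxhat Cx.
have [df _] := f_C1.
have rX := right_continuous0 T0 cX; rewrite X0 in rX.
have rXh := right_continuous0 T0 cXh; rewrite Xh0 in rXh.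
have eX : t^-1 *: (X t - x) @[t --> 0^'+] --> f x.
  rewrite -X0; apply: (right_derivative T0 cX dX); rewrite X0.
  exact: (cvg_comp X f rX (differentiable_continuous (df x))).
have eXh : t^-1 *: (Xhat t - xhat) @[t --> 0^'+] --> F xhat (h x).
  rewrite -[in X in nbhs X]Xh0 -Xh0; apply: (right_derivative T0 cXh dXh); rewrite Xh0.
  apply: observer_cvg; first exact: rXh.
  exact: (cvg_comp X h rX (@output_continuous x)).
have tpos : \forall t \near (0 : R)^'+, 0 < t by exact: nbhs_right_gt.
have near1 (Z : R -> 'rV[R]_n) (z : 'rV[R]_n) : Z t @[t --> (0 : R)^'+] --> z ->
    \forall t \near (0 : R)^'+, `|Z t - z| <= 1.
  move=> /cvgrPdist_le/(_ _ ltr01); apply: filterS => t.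
  by rewrite distrC.
have nX := near1 _ _ rX; have nXh := near1 _ _ rXh.
have scale (t : R) (v : 'rV[R]_n) : 0 < t -> v = t *: (t^-1 *: v).
  by move=> t0; rewrite scalerA divff ?gt_eqF// scale1r.
have nscale (t : R) (v : 'rV[R]_n) : 0 < t -> `|v| = t * `|t^-1 *: v|.
  by move=> t0; rewrite {1}(scale t v t0) normrZ gtr0_norm.
(* When the two points coincide the observer has no error, both solutions leave with
   the same velocity, and their distance is o(t). *)
have [L00|Lpos] := eqVneq L 0.
  have xx : xhat = x by rewrite -g0 -gL L00.
  have Fx : F xhat (h x) = f x.
    by rewrite xx /F /observer grad1_sqdist subrr scaler0 !mul0mx scaler0 subr0.
  rewrite -LE L00 mulr0.
  have [K K0 PK] := dist_le_norm P_C2 (`|x| + 1).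
  apply: (@upper_dini_le _ _ (fun t => K * `|t^-1 *: (X t - x) - t^-1 *: (Xhat t - xhat)|)).
    near=> t.
    have t0 : 0 < t by near: t.
    rewrite X0 Xh0 -LE L00 subr0 ler_pdivrMr//.
    have xb (y : 'rV[R]_n) : `|y - x| <= 1 -> `|y| <= `|x| + 1.
      by move=> yx; rewrite -[y](subrK x) addrC (le_trans (ler_normD _ _))// lerD2l.
    have H1 : `|Xhat t| <= `|x| + 1 by apply: xb; rewrite -xx; near: t.
    have H2 : `|X t| <= `|x| + 1 by apply: xb; near: t.
    rewrite (le_trans (PK _ _ H1 H2))// -mulrA ler_wpM2l// mulrC.
    rewrite -scalerBr -nscale// xx.
    by rewrite opprB addrA subrK.
  have cd : `|t^-1 *: (X t - x) - t^-1 *: (Xhat t - xhat)| @[t --> 0^'+] --> (0 : R).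
    have := cvg_norm (cvgB eX eXh); rewrite Fx subrr normr0 => H.
    exact: (H _ _).
  have := cvgM (cvg_cst K) cd; rewrite mulr0 => H; exact: H.
have {}Lpos : 0 < L by rewrite lt_neqAle eq_sym Lpos.
have [K K0 PK] := variation_length P_metric P_C2 geo Lpos.
rewrite g0 gL in PK.
pose D := inner (P x) (derive1 gamma L) (f x) -
  inner (P xhat) (derive1 gamma 0) (F xhat (h x)).
have DL : D <= - (q / 4) * dist P xhat x.
  have stay' t : 0 <= t <= L -> C (gamma t) by exact: stay.
  have gain' t : 0 <= t <= L -> excess h rho (state gamma t) <= q / 4 +
      2 * k xhat * (`|output_rate h (state gamma t)| * `|output_rate h (state gamma 0)|).
    move=> /andP[t0 tL]; apply: gain => //.
      by rewrite t0 (le_trans tL)// LE ltW.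
    by move=> r /andP[r0 rt]; apply: stay; rewrite r0 (le_trans rt).
  have := drift_estimate P_metric P_C2 f_C1 h_C1 level_tg lie_le geo L0 stay' gain'.
  rewrite g0 gL subr0 -LE => /(le_trans _); apply.
  have := inner_observer f k xhat (derive1 gamma 0) (h x) P_metric h_C1.
  rewrite innerBr -g0 -/(state gamma 0) g0 -/F /D.
  move: (output_rate _ _) (inner _ _ _) => *; lra.
apply: (@le_trans _ _ D%:E); last by rewrite lee_fin.
(* Upper bound of the difference quotient; its last summand is the quadratic error of
   variation_length divided by t. *)
pose Q t := inner (P x) (derive1 gamma L) (t^-1 *: (X t - x)) -
  inner (P xhat) (derive1 gamma 0) (t^-1 *: (Xhat t - xhat)) +
  K * (`|t^-1 *: (Xhat t - xhat)| + `|t^-1 *: (X t - x)|) ^+ 2 * t.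
apply: (@upper_dini_le _ _ Q).
  near=> t.
  have t0 : 0 < t by near: t.
  have H1 : `|Xhat t - xhat| <= 1 by near: t.
  have H2 : `|X t - x| <= 1 by near: t.
  have := PK _ _ H1 H2.
  rewrite subr0 [xhat + _]addrC subrK [x + _]addrC subrK X0 Xh0 -LE => H.
  rewrite ler_pdivrMr// lerBlDl (le_trans H)// -!addrA lerD2l /Q.
  rewrite {1}(scale t (X t - x) t0) {1}(scale t (Xhat t - xhat) t0) !innerZr.
  rewrite (nscale t (Xhat t - xhat) t0) (nscale t (X t - x) t0).
  rewrite le_eqVlt; apply/orP; left; apply/eqP; ring.
have c0 : (t : R) @[t --> (0 : R)^'+] --> (0 : R).
  by apply: cvg_at_right_filter; exact: cvg_id.
have n1 : `|t^-1 *: (Xhat t - xhat)| @[t --> (0 : R)^'+] --> `|F xhat (h x)|.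
  exact: (cvg_norm eXh).
have n2 : `|t^-1 *: (X t - x)| @[t --> (0 : R)^'+] --> `|f x|.
  exact: (cvg_norm eX).
have cn : (`|t^-1 *: (Xhat t - xhat)| + `|t^-1 *: (X t - x)|) @[t --> (0 : R)^'+] -->
    `|F xhat (h x)| + `|f x| by exact: cvgD.
have cL : inner (P x) (derive1 gamma L) (t^-1 *: (X t - x)) @[t --> (0 : R)^'+] -->
    inner (P x) (derive1 gamma L) (f x).
  by apply: cvg_inner; [exact: cvg_cst|exact: cvg_cst|exact: eX].
have cR : inner (P xhat) (derive1 gamma 0) (t^-1 *: (Xhat t - xhat))
    @[t --> (0 : R)^'+] --> inner (P xhat) (derive1 gamma 0) (F xhat (h x)).
  by apply: cvg_inner; [exact: cvg_cst|exact: cvg_cst|exact: eXh].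
have cQ : Q t @[t --> (0 : R)^'+] -->
    D + K * ((`|F xhat (h x)| + `|f x|) * (`|F xhat (h x)| + `|f x|)) * 0.
  apply: cvgD; first exact: cvgB.
  apply: cvgM; last exact: c0.
  by apply: cvgM; [exact: cvg_cst|exact: (cvgM cn cn)].
by rewrite mulr0 addr0 in cQ.
Unshelve. all: by end_near. Qed.

End decay.

Theorem theorem3p3 (R : realType) (n m : nat)
    (f : 'rV[R]_n -> 'rV[R]_n) (h : 'rV[R]_n -> 'rV[R]_m)
    (f_C1 : Ck 1 f) (h_C1 : Ck 1 h) (f_complete : forward_complete f)
    (P : 'rV[R]_n -> 'M[R]_n)
    (P_metric : riemannian_metric P) (P_C2 : Ck 2 P)
    (P_complete : complete_metric P)
    (C : set 'rV[R]_n)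
    (C_convex : geodesically_convex P C) (C_closed : closed C)
    (C_interior : C° !=set0)
    (rho : 'rV[R]_n -> R) (rho_C1 : Ck 1 rho) (rho_ge0 : forall x, 0 <= rho x)
    (q : R) (q_gt0 : 0 < q)
    (lie_le : forall x, C x -> forall v,
       lie_form f P x v <=
         rho x * inner (jacobian h x *m (jacobian h x)^T) v v
         - q * inner (P x) v v)
    (m_eq1 : m = 1%N)
    (level_totally_geodesic : forall y, (h @` C) y ->
       totally_geodesic P (fun x => h x - y) C)
    (E : R) (E_gt0 : 0 < E) :
  exists k : 'rV[R]_n -> R,
    continuous k /\
    let F := observer (@sqdist R m) P f h k in
    [/\ forall x xhat, dist P xhat x < E -> C° x -> C° xhat ->
          forall T X Xhat, 0 < T -> X 0 = x -> Xhat 0 = xhat ->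
            solution (fun=> f) T X ->
            solution (fun t z => F z (h (X t))) T Xhat ->
            (upper_dini (fun t => dist P (Xhat t) (X t))
               <= (- (q / 4) * dist P xhat x)%:E)%E,
        intrinsic (@sqdist R m) P f h k F &
        infinite_gain_margin_on C P f h F].
Proof.
subst m.
have q4 : 0 < q / 4 by rewrite divr_gt0.
have /choice[kappa Hkappa] : forall N : nat, exists kappa, forall kappa', kappa <= kappa' ->
  forall gamma s, geodesic P setT gamma ->
    `|gamma 0| <= N%:R -> 0 <= s <= E -> stays_in C gamma s ->
    excess h rho (state gamma s) <= q / 4 +
      kappa' * (`|output_rate h (state gamma s)| * `|output_rate h (state gamma 0)|).
  move=> N; exact: (gain_exists P_metric P_C2 P_complete h_C1 C_closed
    level_totally_geodesic rho_C1 rho_ge0 N%:R q4 (ltW E_gt0)).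
have [k [kc kpos kmaj]] := continuous_majorant n kappa.
exists k; split; first exact: kc.
split.
- move=> x xhat dE Cx Cxhat T X Xhat.
  apply: (dini_decay P_metric P_C2 P_complete f_C1 h_C1 C_convex
    level_totally_geodesic lie_le kc (interior_subset Cx) (interior_subset Cxhat) dE).
  move=> gamma s geo g0 sE stay.
  have [N xN kN] := kmaj xhat.
  apply: (Hkappa N) => //; last by rewrite g0.
  by rewrite (le_trans kN)// ler_peMl// ?ler1n// ltW.
- by apply: intrinsic_observer => // x; exact: metric_unitmx.
- exact: (gain_margin P_metric P_complete f h_C1 level_totally_geodesic kpos).
Qed.
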